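(* Let $\alpha$ be a cyclotomic integer of length $l(\alpha)=4$. Then $$[\mathbb{Q}_{c(\alpha)}:\mathbb{Q}(\alpha)] \leq 6.$$ Moreover, equality holds if and only if $\alpha$ is of the form $$\epsilon\left(\zeta_6^{c}+\zeta_7^{a}+\zeta_7^{2a}+\zeta_7^{4a}\right),$$ where $c\in(\mathbb{Z}/6\mathbb{Z})^\times$, $a\in(\mathbb{Z}/7\mathbb{Z})^\times$, and $\epsilon$ is a root of unity whose order is a multiple of $4$ not divisible by either $3$ or $7$.
   Context: For a positive integer $n$, $\mathbb{Q}_n$ denotes the extension of $\mathbb{Q}$ generated by a primitive $n$th root of unity in $\mathbb{C}$, and $\zeta_m=e^{2\pi i/m}$. A cyclotomic integer is an algebraic integer that can be expressed as a sum of complex roots of unity (repetitions allowed). A representation $\alpha=\sum_{i=1}^k \epsilon_i$ with each $\epsilon_i$ a root of unity has weight $k$. The length $l(\alpha)$ of a cyclotomic integer $\alpha$ is the smallest weight among all representations of $\alpha$ as a sum of roots of unity. The conductor $c(\alpha)$ is the smallest positive integer such that $\mathbb{Q}(\alpha)\subseteq\mathbb{Q}_{c(\alpha)}$ (unrelated to the exponent $c$). The order of a root of unity is its multiplicative order. *)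

(* Defs.v *)
From HB Require Import structures.
From mathcomp Require Import all_boot all_order all_algebra all_field.

Set Implicit Arguments.
Unset Strict Implicit.
Unset Printing Implicit Defensive.

Import Order.TTheory GRing.Theory Num.Theory.
Local Open Scope ring_scope.

(* Every number occurring here is algebraic, so C is represented by algC.     *)

Definition root_of_unity (x : algC) : Prop :=
  exists2 n : nat, (0 < n)%N & n.-unity_root x.

Definition sum_of_roots_of_unity (k : nat) (alpha : algC) : Prop :=
  exists s : seq algC, [/\ size s = k,
    forall x, x \in s -> root_of_unity x & alpha = \sum_(x <- s) x].

Definition cyclotomic_integer (alpha : algC) : Prop :=
  alpha \in Aint /\ exists k, sum_of_roots_of_unity k alpha.

Definition has_length (alpha : algC) (k : nat) : Prop :=
  sum_of_roots_of_unity k alpha /\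
  forall j, sum_of_roots_of_unity j alpha -> (k <= j)%N.

(* m.-root (-1) is the m-th root of -1 of largest real part among those with  *)
(* nonnegative imaginary part, i.e., e^(i pi / m) (and -1 for m = 1), so that *)
(* its square is e^(2 i pi / m).                                              *)
Definition zeta (m : nat) : algC := m.-root (-1) ^+ 2.

(* The number field Q(x, y), as an abstract extension of rat, together with   *)
(* its embedding into algC and the elements xQ, yQ that embed to x, y.        *)
Definition numfield2 (x y : algC) : fieldExtType rat :=
  projT1 (num_field_exists [:: x; y]).

Definition numfield2C (x y : algC) : {rmorphism numfield2 x y -> algC} :=
  projT1 (projT2 (num_field_exists [:: x; y])).

Definition numfield2_gens (x y : algC) : seq (numfield2 x y) :=
  s2val (projT2 (projT2 (num_field_exists [:: x; y]))).

Definition adjl (x y : algC) : {subfield numfield2 x y} :=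
  <<1; (numfield2_gens x y)`_0>>%AS.

Definition adjr (x y : algC) : {subfield numfield2 x y} :=
  <<1; (numfield2_gens x y)`_1>>%AS.

(* Q(x) is included in Q(y). *)
Definition Q_sub (x y : algC) : bool := (adjl x y <= adjr x y)%VS.

(* The degree [Q(y) : Q(x)], meaningful when Q_sub x y holds. *)
Definition Q_degree (y x : algC) : nat := \dim_(adjl x y) (adjr x y).

(* A primitive n-th root of unity (for n > 0), which generates Q_n. *)
Definition cyc_gen (n : nat) : algC := sval (C_prim_root_exists (ltn0Sn n.-1)).

Definition has_conductor (alpha : algC) (n : nat) : Prop :=
  [/\ (0 < n)%N, Q_sub alpha (cyc_gen n) &
      forall m, (0 < m)%N -> Q_sub alpha (cyc_gen m) -> (n <= m)%N].

(* The definitions above do not depend on the choices made by                 *)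
(* num_field_exists and C_prim_root_exists, and conductors exist.             *)

Lemma cyc_genP n : (0 < n)%N -> n.-primitive_root (cyc_gen n).
Proof. by rewrite /cyc_gen; case: C_prim_root_exists => z /= + n0; rewrite prednK. Qed.

Lemma numfield2_gensE x y :
  map (numfield2C x y) (numfield2_gens x y) = [:: x; y].
Proof.
by rewrite /numfield2_gens /numfield2C; case: (projT2 (projT2 (num_field_exists [:: x; y]))).
Qed.

Lemma numfield2_gen0 x y : numfield2C x y (numfield2_gens x y)`_0 = x.
Proof.
have := numfield2_gensE x y.
by case: numfield2_gens => [|u [|v []]] //= [].
Qed.

Lemma numfield2_gen1 x y : numfield2C x y (numfield2_gens x y)`_1 = y.
Proof.
have := numfield2_gensE x y.
by case: numfield2_gens => [|u [|v []]] //= [].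
Qed.

Lemma map_horner_ratr (L : fieldExtType rat) (iota : {rmorphism L -> algC})
    (p : {poly rat}) (a : L) :
  iota (map_poly (in_alg L) p).[a] = (map_poly ratr p).[iota a].
Proof.
rewrite -horner_map -map_poly_comp; congr (_.[_]).
by apply: eq_map_poly => c /=; rewrite rmorphZ_num rmorph1 mulr1.
Qed.

Lemma polyOver1_rat (L : fieldExtType rat) (p : {poly L}) :
  p \is a polyOver 1%VS -> exists q, p = map_poly (in_alg L) q.
Proof.
move=> Kp; exists (\poly_(i < size p) projT1 (sig_eqW (vlineP _ _ (polyOverP Kp i)))).
apply/polyP=> i; rewrite coef_map coef_poly.
case: ltnP => [_ | /leq_sizeP->//]; last by rewrite /= scale0r.
by case: sig_eqW => k /=.
Qed.

Lemma mem_adjoin_iota (L : fieldExtType rat) (iota : {rmorphism L -> algC})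
    (a b : L) :
  reflect (exists p : {poly rat}, iota a = (map_poly ratr p).[iota b])
          (a \in <<1; b>>%VS).
Proof.
apply: (iffP Fadjoin_polyP) => [[p /polyOver1_rat[q ->] ->] | [p Da]].
  by exists q; rewrite map_horner_ratr.
exists (map_poly (in_alg L) p); last first.
  by apply: (fmorph_inj iota); rewrite map_horner_ratr.
by apply/polyOverP => i; rewrite coef_map /= rpredZ ?mem1v.
Qed.

Lemma sub_adjoin1 (L : fieldExtType rat) (u v : L) :
  (<<1; u>> <= <<1; v>>)%VS = (u \in <<1; v>>%VS).
Proof.
apply/idP/idP=> [/subvP-> //|uv]; first exact: memv_adjoin.
by apply/FadjoinP; split=> //; apply: sub1v.
Qed.

Lemma Q_subE (L : fieldExtType rat) (iota : {rmorphism L -> algC}) (a b : L) :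
  Q_sub (iota a) (iota b) = (<<1; a>> <= <<1; b>>)%VS.
Proof.
rewrite /Q_sub !sub_adjoin1.
by apply/(mem_adjoin_iota (numfield2C _ _))/(mem_adjoin_iota iota);
   rewrite numfield2_gen0 numfield2_gen1.
Qed.

Lemma Q_subP x y :
  reflect (exists p : {poly rat}, x = (map_poly ratr p).[y]) (Q_sub x y).
Proof.
rewrite /Q_sub sub_adjoin1.
apply: (iffP (mem_adjoin_iota (numfield2C _ _) _ _));
  by rewrite numfield2_gen0 numfield2_gen1.
Qed.

Lemma dim_adjoin_iota (L M : fieldExtType rat) (f : {rmorphism L -> algC})
    (g : {rmorphism M -> algC}) (a : L) (b : M) :
  f a = g b -> \dim <<1; a>> = \dim <<1; b>>.
Proof.
have le (L' M' : fieldExtType rat) (f' : {rmorphism L' -> algC})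
    (g' : {rmorphism M' -> algC}) (u : L') (v : M') :
  f' u = g' v -> (\dim <<1; u>> <= \dim <<1; v>>)%N.
  move=> e; rewrite !dim_Fadjoin !dimv1 !muln1 -ltnS -!size_minPoly.
  have [q Dq] := polyOver1_rat (minPolyOver 1 v).
  have sq: size (minPoly 1 v) = size (map_poly (in_alg L') q).
    by rewrite Dq !size_map_poly.
  rewrite sq; apply: dvdp_leq.
    by rewrite -size_poly_gt0 -sq size_minPoly.
  apply: minPoly_dvdp.
    by apply/polyOverP => i; rewrite coef_map /= rpredZ ?mem1v.
  have /rootP := root_minPoly 1 v; rewrite Dq => /(congr1 g').
  rewrite map_horner_ratr rmorph0 -e -map_horner_ratr => /eqP.
  by rewrite fmorph_eq0.
by move=> e; apply/eqP; rewrite eqn_leq (le _ _ _ _ _ _ e) (le _ _ _ _ _ _ (esym e)).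
Qed.

Lemma Q_degreeE (L : fieldExtType rat) (iota : {rmorphism L -> algC}) (a b : L) :
  Q_degree (iota b) (iota a) = \dim_(<<1; a>>%VS) <<1; b>>.
Proof.
congr (_ %/ _)%N; apply: (dim_adjoin_iota (f := numfield2C _ _) (g := iota));
by rewrite ?numfield2_gen0 ?numfield2_gen1.
Qed.

Lemma has_conductor_exists alpha :
  cyclotomic_integer alpha -> exists n, has_conductor alpha n.
Proof.
case=> _ [k [s [_ s1 Da]]].
have [N N0 sN]: exists2 N, (0 < N)%N & forall x, x \in s -> x ^+ N = 1.
  elim: s s1 {Da} => [|x s IHs] s1; first by exists 1%N.
  have [|N N0 sN] := IHs; first by move=> y ys; apply: s1; rewrite inE ys orbT.
  have [|m m0 /unity_rootP xm] := s1 x; first by rewrite inE eqxx.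
  exists (m * N)%N => [|y]; first by rewrite muln_gt0 m0.
  rewrite inE => /orP[/eqP-> | /sN yN]; first by rewrite exprM xm expr1n.
  by rewrite mulnC exprM yN expr1n.
have exN: exists m, (0 < m)%N && Q_sub alpha (cyc_gen m).
  exists N; rewrite N0; apply/Q_subP; rewrite Da {Da s1}.
  elim: s sN => [|x s IHs] sN; first by exists 0; rewrite big_nil rmorph0 horner0.
  have [|p Dp] := IHs; first by move=> y ys; apply: sN; rewrite inE ys orbT.
  have [|i ->] := prim_rootP (cyc_genP N0) (_ : x ^+ N = 1).
    by apply: sN; rewrite inE eqxx.
  exists ('X^i + p); rewrite big_cons Dp.
  by rewrite rmorphD /= map_polyXn hornerD hornerXn.
case: (ex_minnP exN) => n /andP[n0 an] nmin; exists n; split=> // m m0 am.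
by apply: nmin; rewrite m0.
Qed.

Lemma has_conductor_unique alpha m n :
  has_conductor alpha m -> has_conductor alpha n -> m = n.
Proof.
by case=> m0 am minm [n0 an minn]; apply/eqP; rewrite eqn_leq minm ?minn.
Qed.

(* Main.v *)
(* Two representations of a number of length at most 4 as a sum of four roots of unity
   give a vanishing sum of weight at most 8.  Splitting it according to the p-part of
   its terms and using minimality, one finds that the representations coincide unless,
   up to a common term and a rotation, they consist of 30th roots of unity, or they are
   u (z + w^a + w^b + w^c) = - u (- (z - 1) + w^d + w^e + w^f) with z of order 6, w of
   order 7 and {a,...,f} = {1,...,6}.

   Let H be the group of automorphisms fixing alpha, modulo those fixing each of its
   four terms; its order bounds the degree.  If H permutes the terms, then |H| <= 4,
   because H is abelian.  If the terms are 30th roots of unity up to rotation, then H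
   embeds in (Z/30)^*, of order 8, and does not contain the class of 7, hence again
   |H| <= 4; if this holds for three of the terms only, then H fixes the remaining
   one.  Otherwise H embeds in (Z/42)^*, and only six classes can occur; all of them do
   only if {a,b,c} is a coset of the squares modulo 7.  The action on the rotation u of
   the classes of 37 (trivial) and 41 (a change of sign) then yields the conditions on
   the order of u.  The finitely many inequalities between sums of 30th or 42nd roots
   of unity that are needed are checked modulo a prime. *)

Require Import Defs.
From HB Require Import structures.
From mathcomp Require Import all_boot all_order all_algebra all_field.
From mathcomp Require Import fingroup morphism quotient integral_char ring zify.
From Stdlib Require BinNat Nnat Pnat PeanoNat.
Import Defs.

Set Implicit Arguments.
Unset Strict Implicit.
Unset Printing Implicit Defensive.

Import Order.TTheory GRing.Theory Num.Theory.
Local Open Scope ring_scope.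

(** * Galois groups of cyclotomic fields *)

(** Let the ratios of the terms be roots of unity of order dividing p q, with p prime, and sort the
    terms by cosets of the q-th roots of unity. If p divides q, Fourier inversion over automorphisms
    shows that both representations have the same sum over each coset, so a repeated prime factor
    can always be removed. If p does not divide q, the exponent that is 0 modulo p defines no
    automorphism, and the p coset sums are only known to differ by v y, with one constant v and y
    running over the p-th roots of unity. If v is nonzero, each of the p cosets must contain one of
    the at most eight terms: this singles out p = 7 among the primes above 5, while 2, 3 and 5 may
    survive and give 30.

    Degrees become indices of stabilizers in the units modulo a multiple M of all orders involved.
    An automorphism fixing all terms fixes the conductor field, since the conductor divides the
    least common exponent of the terms; hence bounding the index of the stabilizer of the terms is
    enough for the inequality. For the converse, 3 and 7 divide the conductor, so residues modulo 3
    and 7 tell six cosets apart. *)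

Section CyclotomicAutomorphisms.

Variable m : nat.
Local Notation M := m.+2.
Local Notation G := {unit 'I_M}.

Lemma unit_Zp_coprime (u : G) : coprime (val u) M.
Proof.
have := valP u; rewrite -[X in X \is a _](natr_Zp (val u)).
by rewrite (@unitZpE M) // coprime_sym.
Qed.

(** The extension to all of [algC] is chosen separately for each [u], so compatibility with products
    is only available on the field generated by [cyc_gen M]. *)
Definition cycaut (u : G) : {rmorphism algC -> algC} :=
  sval (Qn_aut_exists (unit_Zp_coprime u)).

Lemma cycautE (u : G) z : z ^+ M = 1 -> cycaut u z = z ^+ val u.
Proof. by move=> zM; rewrite /cycaut; case: Qn_aut_exists => /= f ->. Qed.

Lemma unit_of_coprime k : coprime k M -> {u : G | val u = inZp k}.
Proof.
move=> kM; have Uk : (inZp k : 'I_M) \is a GRing.unit.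
  by rewrite -Zp_nat (@unitZpE M) // coprime_sym.
by exists (FinRing.unit _ Uk).
Qed.

Lemma cycaut_unit_of (u : G) k z :
  val u = inZp k -> z ^+ M = 1 -> cycaut u z = z ^+ k.
Proof. by move=> Du zM; rewrite cycautE // Du /= expr_mod. Qed.

Lemma cycautM_root (u v : G) z :
  z ^+ M = 1 -> cycaut (u * v)%g z = cycaut u (cycaut v z).
Proof.
move=> zM; rewrite (cycautE v) // rmorphXn /= !cycautE // -exprM.
by rewrite /= expr_mod.
Qed.

Lemma cyc_gen_exp : cyc_gen M ^+ M = 1.
Proof. exact: prim_expr_order (cyc_genP _). Qed.

Lemma cycaut_Q (f g : {rmorphism algC -> algC}) x :
  f (cyc_gen M) = g (cyc_gen M) -> Q_sub x (cyc_gen M) -> f x = g x.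
Proof.
move=> fg /Q_subP[p ->]; rewrite -!horner_map fg -!map_poly_comp.
by congr (_.[_]); apply: eq_map_poly => c /=; rewrite !fmorph_rat.
Qed.

Lemma cycautM (u v : G) x : Q_sub x (cyc_gen M) ->
  cycaut (u * v)%g x = cycaut u (cycaut v x).
Proof.
move=> Qx; apply: (@cycaut_Q _ (cycaut u \o cycaut v)) => //=.
exact/cycautM_root/cyc_gen_exp.
Qed.

Lemma cycaut1 x : Q_sub x (cyc_gen M) -> cycaut 1 x = x.
Proof.
move=> Qx; apply: (@cycaut_Q _ idfun) => //=.
by rewrite cycautE ?cyc_gen_exp.
Qed.

Definition stab x : {set G} := [set u | cycaut u x == x].

Lemma stabP u x : reflect (cycaut u x = x) (u \in stab x).
Proof. by rewrite inE; apply: eqP. Qed.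

Lemma stab_group_set x : Q_sub x (cyc_gen M) -> group_set (stab x).
Proof.
move=> Qx; apply/group_setP; split; first exact/stabP/cycaut1.
by move=> u v /stabP ux /stabP vx; apply/stabP; rewrite cycautM // vx.
Qed.

Definition stabG x (Qx : Q_sub x (cyc_gen M)) : {group G} :=
  Group (stab_group_set Qx).

(** An automorphism of [L] is determined by the image of [w], which is a power of [w] with exponent
    prime to [M]; this matches the Galois group with the units modulo [M] and subgroups fixing an
    element with [stab]. *)
Lemma stab_galois (L : splittingFieldType rat) (QC : {rmorphism L -> algC})
    (w : L) :
  galois 1 {:L} -> M.-primitive_root w -> <<1; w>>%VS = fullv ->
  exists f : G -> gal_of {:L},
    [/\ injective f, forall s, exists u, s = f u &
        forall a u, (f u \in 'Gal({:L} / <<1; a>>))%g = (u \in stab (QC a))].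
Proof.
move=> galL prw genw.
have /fin_all_exists2[f fG fC] (u : G) : exists2 s : gal_of {:L},
    s \in ('Gal({:L} / 1))%g & forall x, QC (s x) = cycaut u (QC x).
  have [nu Dnu] := restrict_aut_to_normal_num_field QC (cycaut u).
  have hom_nu: kHom 1 {:L} (linfun nu).
    rewrite k1HomE; apply/ahom_inP.
    by split=> [x y | ]; rewrite !lfunE ?rmorphM ?rmorph1.
  have [|s Gs Ds] := kHom_to_gal _ (normalFieldf 1) hom_nu; first by rewrite !subvf.
  by exists s => // x; rewrite -Ds ?memvf // lfunE /= Dnu.
have galE (s t : gal_of {:L}) : s w = t w -> s = t.
  move=> st; have galT (r : gal_of {:L}) : r \in ('Gal({:L} / 1))%g.
    by rewrite gal_kHom ?subvf // k1AHom.
  apply/eqP/gal_eqP => x _; have: x \in <<1; w>>%VS by rewrite genw memvf.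
  case/Fadjoin_polyP => p Kp ->; rewrite -!horner_map.
  by rewrite !(fixedPoly_gal (subvf _) (galT _)) ?Kp //= st.
have QwM : QC w ^+ M = 1 by rewrite -rmorphXn prim_expr_order ?rmorph1.
exists f; split=> [u v fuv|s|a u].
- apply/val_inj/val_inj => /=; have := congr1 (fun s : gal_of _ => QC (s w)) fuv.
  rewrite /= !fC !cycautE // => /eqP.
  have prQ : M.-primitive_root (QC w) by rewrite fmorph_primitive_root.
  by rewrite (eq_prim_root_expr prQ) !modn_small ?ltn_ord // => /eqP.
- have prs: M.-primitive_root (s w) by rewrite fmorph_primitive_root.
  have [i Di] := prim_rootP prw (prim_expr_order prs).
  rewrite Di prim_root_exp_coprime // in prs.
  have [u Du] := unit_of_coprime prs.
  exists u; apply: galE; apply: (fmorph_inj QC).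
  by rewrite fC (cycaut_unit_of Du) // Di rmorphXn.
- rewrite gal_kHom ?subvf //; apply/kHomP/stabP => [[_ fa]|fa].
    by rewrite -fC fa ?memv_adjoin.
  split=> [x y _ _|x]; first exact: rmorphM.
  case/(mem_adjoin_iota QC) => p Dp; apply: (fmorph_inj QC).
  rewrite fC Dp -horner_map fa -map_poly_comp.
  by congr (_.[_]); apply: eq_map_poly => c /=; rewrite !fmorph_rat.
Qed.

Lemma stab_gal_card (L : splittingFieldType rat) (QC : {rmorphism L -> algC})
    (w a : L) :
  galois 1 {:L} -> M.-primitive_root w -> <<1; w>>%VS = fullv ->
  #|('Gal({:L} / <<1; a>>))%g| = #|stab (QC a)|.
Proof.
move=> galL prw genw; have [f [f_inj f_surj fE]] := stab_galois QC galL prw genw.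
rewrite -(card_imset _ f_inj); apply/eq_card => s.
have [u ->] := f_surj s; rewrite fE; apply/idP/imsetP => [ua | [v va /f_inj-> //]].
by exists u.
Qed.

Lemma cyc_splitting_field :
  exists (L : splittingFieldType rat) (QC : {rmorphism L -> algC}) (w : L),
    [/\ galois 1 {:L}, M.-primitive_root w, <<1; w>>%VS = fullv &
        forall x, Q_sub x (cyc_gen M) -> exists a, QC a = x].
Proof.
have [L galL [QC _ [w [prw genw] _]]] := group_num_field_exists (Zp_group M).
rewrite card_Zp // in prw; exists L, QC, w; split=> // x /Q_subP[p Dp].
have prQ : M.-primitive_root (QC w) by rewrite fmorph_primitive_root.
have [i Di] := prim_rootP prQ cyc_gen_exp.
by exists (map_poly (in_alg L) p).[w ^+ i]; rewrite map_horner_ratr rmorphXn -Di -Dp.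
Qed.

(** The Galois correspondence, transported to units modulo [M]; together with the degree formula
    below it removes abstract number fields from the rest of the proof. *)
Lemma Q_sub_stab x y : Q_sub x (cyc_gen M) -> Q_sub y (cyc_gen M) ->
  Q_sub x y = (stab y \subset stab x).
Proof.
have [L [QC [w [galL prw genw QM]]]] := cyc_splitting_field.
move=> /QM[a <-] /QM[b <-]; rewrite Q_subE.
have galS c : galois <<1; c>> {:L} by apply: galoisS galL; rewrite sub1v subvf.
have [f [f_inj f_surj fE]] := stab_galois QC galL prw genw.
rewrite -{1}(galois_fixedField (galS b)) -galois_connection ?subvf //.
apply/subsetP/subsetP => [ab u | ba s]; first by rewrite -!fE; apply: ab.
by have [u ->] := f_surj s; rewrite !fE; apply: ba.
Qed.

Lemma Q_degree_stab x y : Q_sub x (cyc_gen M) -> Q_sub y (cyc_gen M) ->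
  Q_degree y x = (#|stab x| %/ #|stab y|)%N.
Proof.
have [L [QC [w [galL prw genw QM]]]] := cyc_splitting_field.
move=> /QM[a <-] /QM[b <-]; rewrite Q_degreeE.
have dimE c : (\dim {:L} = #|stab (QC c)| * \dim <<1; c>>)%N.
  rewrite -(stab_gal_card QC c galL prw genw) -galois_dim; last first.
    by apply: galoisS galL; rewrite sub1v subvf.
  by rewrite divnK // field_dimS // subvf.
have a0 : (0 < \dim <<1; a>>)%N by apply: adim_gt0.
have b0 : (0 < \dim <<1; b>>)%N by apply: adim_gt0.
have sb0 : (0 < #|stab (QC b)|)%N.
  by have := dimE b; have := adim_gt0 {:L}%AS; case: #|_| => // /[swap] ->.
rewrite -(divnMr sb0) [X in (X %/ _)%N]mulnC -dimE (dimE a).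
by rewrite [X in (_ %/ X)%N]mulnC divnMr.
Qed.

End CyclotomicAutomorphisms.

(** * Sums of roots of unity of minimal length *)

Lemma root_of_unityP x : root_of_unity x <-> exists2 n, (0 < n)%N & x ^+ n = 1.
Proof. by split=> -[n n0 /unity_rootP xn]; exists n => //; apply/unity_rootP. Qed.

Lemma root_of_unityM x y : root_of_unity x -> root_of_unity y -> root_of_unity (x * y).
Proof.
move=> /root_of_unityP[a a0 xa] /root_of_unityP[b b0 yb]; apply/root_of_unityP.
exists (a * b)%N; first by rewrite muln_gt0 a0.
by rewrite exprMn exprM xa expr1n mul1r mulnC exprM yb expr1n.
Qed.

Lemma root_of_unityV x : root_of_unity x -> root_of_unity x^-1.
Proof.
move=> /root_of_unityP[a a0 xa]; apply/root_of_unityP.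
by exists a; rewrite // exprVn xa invr1.
Qed.

Lemma root_of_unityN x : root_of_unity x -> root_of_unity (- x).
Proof.
move=> xU; rewrite -mulN1r; apply: root_of_unityM => //.
by apply/root_of_unityP; exists 2; rewrite ?sqrrN ?expr1n.
Qed.

Lemma expr_eq1_neq0 n (x : algC) : (0 < n)%N -> x ^+ n = 1 -> x != 0.
Proof.
move=> n0; apply: contra_eq_neq => ->.
by rewrite expr0n gtn_eqF // eq_sym oner_eq0.
Qed.

Lemma root_of_unity_neq0 x : root_of_unity x -> x != 0.
Proof. by move=> /root_of_unityP[n]; apply: expr_eq1_neq0. Qed.

Lemma prim_root2 (y : algC) : 2.-primitive_root y -> y = -1.
Proof.
move=> y2; have /eqP := prim_expr_order y2; rewrite sqrf_eq1 => /orP[|/eqP //].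
by rewrite -{1}[y]expr1 -[1](expr0 y) (eq_prim_root_expr y2).
Qed.

Lemma sixth_root_cube (z : algC) : 6.-primitive_root z -> z ^+ 3 = -1.
Proof. by move=> z6; apply/prim_root2/(dvdn_prim_root z6 (isT : 2 %| 6)%N). Qed.

Lemma root_of_unity_conj x : root_of_unity x -> x^* = x^-1.
Proof.
move=> /root_of_unityP[a a0 xa]; have nx : `|x| = 1.
  by apply/eqP; rewrite -(pexpr_eq1 a0) // -normrX xa normr1.
by rewrite -[x^*]mulr1 invC_norm nx expr1n invr1 mul1r mulr1.
Qed.

(** Minimality is a property of the list and not of its sum, so that it can be inherited by
    sublists. *)
Definition minrep (s : seq algC) :=
  (forall x, x \in s -> root_of_unity x) /\
  forall t, (forall x, x \in t -> root_of_unity x) ->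
    \sum_(x <- t) x = \sum_(x <- s) x -> (size s <= size t)%N.

Lemma minrep_perm s t : perm_eq s t -> minrep s -> minrep t.
Proof.
move=> st [sU smin]; split=> [x | r rU rt]; first by rewrite -(perm_mem st); apply: sU.
by rewrite -(perm_size st) smin // rt (perm_big _ st).
Qed.

Lemma minrep_eq s t : minrep s -> (forall x, x \in t -> root_of_unity x) ->
  size t = size s -> \sum_(x <- t) x = \sum_(x <- s) x -> minrep t.
Proof.
by move=> [_ smin] tU ts Sts; split=> // r rU rt; rewrite ts smin // rt.
Qed.

Lemma minrep_catl s t : minrep (s ++ t) -> minrep s.
Proof.
move=> [stU stmin]; split=> [x xs | r rU rs].
  by apply: stU; rewrite mem_cat xs.
rewrite -(leq_add2r (size t)) -!size_cat stmin ?big_cat /= ?rs //.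
move=> x; rewrite mem_cat => /orP[/rU // | xt].
by apply: stU; rewrite mem_cat xt orbT.
Qed.

Lemma minrep_filter P s : minrep s -> minrep (filter P s).
Proof.
by move=> s_min; apply: (@minrep_catl _ (filter (predC P) s));
   apply: minrep_perm s_min; rewrite perm_sym perm_filterC.
Qed.

Lemma minrep_size s t : minrep s -> minrep t ->
  \sum_(x <- s) x = \sum_(x <- t) x -> size s = size t.
Proof.
move=> [sU smin] [tU tmin] st; apply/eqP.
by rewrite eqn_leq smin // tmin.
Qed.

Lemma minrep_count P s t : minrep s -> minrep t ->
  \sum_(x <- s | P x) x = \sum_(x <- t | P x) x -> count P s = count P t.
Proof.
move=> s_min t_min; rewrite -!(big_filter _ P) -!size_filter.
by apply: minrep_size; apply: minrep_filter.
Qed.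

Lemma minrep_uniq1 s t : minrep s -> minrep t -> (size s <= 1)%N ->
  \sum_(x <- s) x = \sum_(x <- t) x -> perm_eq s t.
Proof.
move=> s_min t_min ss st; have := minrep_size s_min t_min st.
case: s ss st {s_min} => [|x []] //; case: t {t_min} => [|y []] // _.
by rewrite !big_seq1 => ->.
Qed.

(** Conjugation inverts roots of unity, so the nonzero sum of two of them, divided by its conjugate,
    is their product. Sum and product determine the pair. *)
Lemma minrep_uniq2 s t : minrep s -> minrep t -> (size s <= 2)%N ->
  \sum_(x <- s) x = \sum_(x <- t) x -> perm_eq s t.
Proof.
rewrite leq_eqVlt => s_min t_min /orP[/eqP ss st | /(minrep_uniq1 s_min t_min) //].
have := minrep_size s_min t_min st; rewrite ss.
case: s ss s_min st => [|x1 [|x2 []]] // _ [sU smin].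
case: t t_min => [|y1 [|y2 []]] // [tU _].
rewrite !big_cons !big_nil !addr0 => e _.
have [X1 X2] : root_of_unity x1 /\ root_of_unity x2.
  by split; apply: sU; rewrite !inE eqxx ?orbT.
have [Y1 Y2] : root_of_unity y1 /\ root_of_unity y2.
  by split; apply: tU; rewrite !inE eqxx ?orbT.
have x0 : x1 + x2 != 0.
  apply/eqP=> x0; suff: (2 <= 0)%N by [].
  by apply: (smin [::]) => //; rewrite !big_cons !big_nil addr0 x0.
have vE u v : root_of_unity u -> root_of_unity v -> (u + v)^* * (u * v) = u + v.
  move=> U V; rewrite rmorphD /= !root_of_unity_conj // mulrDl.
  by rewrite mulKf ?root_of_unity_neq0 // mulrCA mulVf ?root_of_unity_neq0 // mulr1 addrC.
have ep : x1 * x2 = y1 * y2.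
  have c0 : (x1 + x2)^* != 0 by rewrite conjC_eq0.
  by apply: (mulfI c0); rewrite vE // {1}e -vE // -e.
have Dy2 : y2 = x1 + x2 - y1 by rewrite e [y1 + _]addrC addrK.
have /eqP: (x1 - y1) * (x1 - y2) = 0.
  have -> : (x1 - y1) * (x1 - y2) = x1 * (x1 - (y1 + y2)) + y1 * y2 by ring.
  by rewrite -e -ep; ring.
rewrite mulf_eq0 !subr_eq0 => /orP[] /eqP Dx.
  have -> : y2 = x2 by rewrite Dy2 -Dx; ring.
  by rewrite -Dx.
rewrite Dx; have -> : x2 = y1 by move: e; rewrite Dx addrC => /addIr.
by rewrite (perm_catC [:: y2] [:: y1]).
Qed.

Lemma sum_aut N k (s t : seq algC) : coprime k N ->
  (forall x, x \in s ++ t -> x ^+ N = 1) ->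
  \sum_(x <- s) x = \sum_(x <- t) x ->
  \sum_(x <- s) x ^+ k = \sum_(x <- t) x ^+ k.
Proof.
move=> /Qn_aut_exists[u uE] stN st.
have sumE r : {subset r <= s ++ t} -> u (\sum_(x <- r) x) = \sum_(x <- r) x ^+ k.
  move=> rst; rewrite rmorph_sum /= !big_seq; apply: eq_bigr => x xr.
  by rewrite uE ?stN ?rst.
rewrite -!sumE ?st // => x; rewrite mem_cat => ->; rewrite ?orbT //.
Qed.

Lemma sum_unity_powers p (z : algC) : z ^+ p = 1 ->
  \sum_(t < p) z ^+ t = if z == 1 then p%:R else 0.
Proof.
move=> zp; case: eqVneq => [-> | z1].
  by under eq_bigr do rewrite expr1n; rewrite sumr_const card_ord.
apply: (mulfI (_ : z - 1 != 0)); first by rewrite subr_eq0.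
by rewrite -subrX1 zp subrr mulr0.
Qed.

Lemma expr_eqmod N (x : algC) a b : x ^+ N = 1 -> a = b %[mod N] -> x ^+ a = x ^+ b.
Proof. by move=> xN ab; rewrite -(expr_mod a xN) ab expr_mod. Qed.

(** * Sums over cosets by Fourier inversion *)

Section ClassSums.

Variables (p q : nat) (s t : seq algC).
Hypotheses (p_pr : prime p) (q0 : (0 < q)%N).
Hypothesis st_unity : forall x, x \in s ++ t -> x ^+ (p * q) = 1.
Hypothesis st_sum : \sum_(x <- s) x = \sum_(x <- t) x.

Let p0 : (p%:R != 0 :> algC). Proof. by rewrite pnatr_eq0 -lt0n prime_gt0. Qed.

(** Averaging [(x ^+ q / y) ^+ i] over i selects the terms with [x ^+ q = y], which expresses the
    class sum through the sums of the powers [x ^+ (1 + i * q)]. Since p divides q, every exponent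
    [1 + i * q] is prime to [p * q], so an automorphism carries the equality of sums over to these
    powers. *)
Lemma class_sum_dvd y : (p %| q)%N ->
  \sum_(x <- s | x ^+ q == y) x = \sum_(x <- t | x ^+ q == y) x.
Proof.
move=> pq; have [yp | yp] := eqVneq (y ^+ p) 1; last first.
  have no r : {subset r <= s ++ t} -> \sum_(x <- r | x ^+ q == y) x = 0.
    move=> rst; rewrite big_seq_cond big1 // => x /andP[/rst xst /eqP xy].
    by rewrite -xy -exprM mulnC st_unity ?eqxx in yp.
  by rewrite !no // => x; rewrite mem_cat => ->; rewrite ?orbT.
have y0 : y != 0 by apply: expr_eq1_neq0 (prime_gt0 p_pr) yp.
have sumE r : {subset r <= s ++ t} ->
    p%:R * \sum_(x <- r | x ^+ q == y) x =
    \sum_(i < p) y ^- i * \sum_(x <- r) x ^+ (1 + i * q).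
  move=> rst; under [RHS]eq_bigr do rewrite mulr_sumr.
  rewrite [RHS]exchange_big big_mkcond mulr_sumr /= !big_seq.
  apply: eq_bigr => x xr.
  have xq : (x ^+ q / y) ^+ p = 1.
    by rewrite exprMn exprVn yp invr1 mulr1 -exprM mulnC st_unity ?rst.
  transitivity (x * \sum_(i < p) (x ^+ q / y) ^+ i).
    rewrite sum_unity_powers // (can2_eq (divfK y0) (mulfK y0)) mul1r.
    by case: eqP => _; rewrite ?mulr0 // mulrC.
  rewrite mulr_sumr; apply: eq_bigr => i _.
  by rewrite exprMn exprVn exprD expr1 [(i * q)%N]mulnC exprM; ring.
apply: (mulfI p0); rewrite !sumE => [|x xr|x xr]; try by rewrite mem_cat xr ?orbT.
apply: eq_bigr => i _; congr (_ * _); apply: sum_aut st_unity st_sum.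
have co d j : coprime (1 + j * d) d.
  by rewrite -coprime_modl addnC modnMDl coprime_modl coprime1n.
by rewrite coprimeMr co andbT; have /dvdnP[j ->] := pq; rewrite mulnA co.
Qed.

Hypothesis pq_co : coprime p q.
(** The idempotents of Z/pq as exponents: [x ^+ e] and [x ^+ f] are the p-part and the q-part of
    x. *)
Let e := chinese p q 1 0.
Let f := chinese p q 0 1.

Let dvd_qe : (q %| e)%N.
Proof. by rewrite /dvdn (chinese_modr pq_co) mod0n. Qed.

Let ep : e = 1 %[mod p].
Proof. by rewrite (chinese_modl pq_co). Qed.

Let dvd_pf : (p %| f)%N.
Proof. by rewrite /dvdn (chinese_modl pq_co) mod0n. Qed.

Let fq : f = 1 %[mod q].
Proof. by rewrite (chinese_modr pq_co). Qed.

Let expf_e (x : algC) : x ^+ (p * q) = 1 -> x ^+ e * x ^+ f = x.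
Proof.
move=> xpq; rewrite -exprD -[RHS]expr1; apply: (expr_eqmod xpq).
apply/eqP; rewrite (chinese_remainder pq_co).
rewrite -[((e + f) %% p)%N]modnDmr (eqP dvd_pf) addn0 ep eqxx /=.
by rewrite -[((e + f) %% q)%N]modnDml (eqP dvd_qe) add0n fq.
Qed.

Let exp_chinese k (x : algC) : x ^+ (p * q) = 1 ->
  x ^+ (chinese p q k 1) = (x ^+ e) ^+ k * x ^+ f.
Proof.
move=> xpq; rewrite -exprM -exprD; apply: (expr_eqmod xpq).
apply/eqP; rewrite (chinese_remainder pq_co).
rewrite (chinese_modl pq_co) (chinese_modr pq_co).
rewrite -[((e * k + f) %% p)%N]modnDmr (eqP dvd_pf) addn0 -modnMml ep modnMml mul1n eqxx /=.
by rewrite -[((e * k + f) %% q)%N]modnDml -modnMml (eqP dvd_qe) mul0n mod0n add0n fq.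
Qed.

(** In the same inversion the exponents are now i modulo p and 1 modulo q. They define automorphisms
    except for i = 0, and this remaining term contributes y times the difference of the sums of the
    q-parts, divided by p. *)
Lemma class_sum_coprime : exists v : algC, forall y, y ^+ p = 1 ->
  \sum_(x <- s | x ^+ e == y) x - \sum_(x <- t | x ^+ e == y) x = v * y.
Proof.
exists ((\sum_(x <- s) x ^+ f - \sum_(x <- t) x ^+ f) / p%:R) => y yp.
have y0 : y != 0 by apply: expr_eq1_neq0 (prime_gt0 p_pr) yp.
have sumE r : {subset r <= s ++ t} ->
    p%:R * \sum_(x <- r | x ^+ e == y) x =
    y * \sum_(x <- r) x ^+ f +
    \sum_(1 <= i < p) (y ^- i * y) * \sum_(x <- r) x ^+ chinese p q i 1.
  move=> rst; under [X in _ + X]eq_bigr do rewrite mulr_sumr.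
  rewrite [X in _ + X]exchange_big mulr_sumr -big_split /=.
  rewrite big_mkcond mulr_sumr /= !big_seq.
  apply: eq_bigr => x xr; have xpq := st_unity (rst x xr).
  have xp : (x ^+ e / y) ^+ p = 1.
    rewrite exprMn exprVn yp invr1 mulr1 -exprM.
    by have /dvdnP[j ->] := dvd_qe; rewrite -mulnA [(q * p)%N]mulnC mulnC exprM xpq expr1n.
  transitivity (y * x ^+ f * \sum_(i < p) (x ^+ e / y) ^+ i).
    rewrite sum_unity_powers // (can2_eq (divfK y0) (mulfK y0)) mul1r.
    case: eqP => [<- | _]; last by rewrite !mulr0.
    by rewrite expf_e // mulrC.
  rewrite -(big_mkord xpredT (fun i => (x ^+ e / y) ^+ i)) big_ltn ?prime_gt0 //.
  rewrite expr0 mulrDr mulr1 mulr_sumr; congr (_ + _); apply: eq_bigr => i _.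
  by rewrite exp_chinese // exprMn exprVn; ring.
have eK : \sum_(1 <= i < p) (y ^- i * y) * \sum_(x <- s) x ^+ chinese p q i 1 =
          \sum_(1 <= i < p) (y ^- i * y) * \sum_(x <- t) x ^+ chinese p q i 1.
  rewrite !big_seq; apply: eq_bigr => i; rewrite mem_index_iota => /andP[i0 ip].
  congr (_ * _); apply: sum_aut st_unity st_sum.
  rewrite coprimeMr -[coprime _ p]coprime_modl -[coprime _ q]coprime_modl.
  rewrite (chinese_modl pq_co) (chinese_modr pq_co) !coprime_modl coprime1n andbT.
  by rewrite coprime_sym prime_coprime // gtnNdvd.
apply: (mulfI p0); rewrite mulrBr !sumE => [|x xr|x xr]; try by rewrite mem_cat xr ?orbT.
rewrite eK; move: p0 (\sum_(1 <= i < p) _) => p0' K.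
by field.
Qed.

End ClassSums.

(** * Two minimal representations of the same number *)

(** Using ratios avoids choosing the rotation that turns the terms into [k]-th roots of unity. *)
Definition near k (s : seq algC) :=
  forall x y, x \in s -> y \in s -> (x / y) ^+ k = 1.

Lemma near_common k s u : u != 0 -> (forall x, x \in s -> (x / u) ^+ k = 1) -> near k s.
Proof.
move=> u0 su x y xs ys; have -> : x / y = (x / u) / (y / u) by rewrite invf_div mulrA divfK.
by rewrite exprMn exprVn !su // mul1r invr1.
Qed.

Lemma near_sub k s t : {subset s <= t} -> near k t -> near k s.
Proof. by move=> st tk x y xs ys; apply: tk; apply: st. Qed.

Lemma near_dvd k l s : (k %| l)%N -> near k s -> near l s.
Proof. by move=> /dvdnP[j ->] sk x y xs ys; rewrite mulnC exprM sk ?expr1n. Qed.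

Lemma sum_class_notin (c : algC -> algC) s y : y \notin map c s ->
  \sum_(x <- s | c x == y) x = 0.
Proof.
move=> ys; rewrite big_seq_cond big1 // => x /andP[xs /eqP xy].
by rewrite -xy map_f in ys.
Qed.

Lemma sum_class_uniq (c : algC -> algC) s x : uniq (map c s) -> x \in s ->
  \sum_(z <- s | c z == c x) z = x.
Proof.
elim: s => //= a s IH /andP[cs us]; rewrite inE big_cons.
case: eqVneq => [-> _ | xa /= xs]; first by rewrite eqxx sum_class_notin ?addr0.
rewrite ifN ?IH //; apply: contraNneq cs => ->; exact: map_f.
Qed.

Lemma not_uniq_map (c : algC -> algC) s : ~~ uniq (map c s) ->
  exists x y r, perm_eq s [:: x, y & r] /\ c x = c y.
Proof.
elim: s => //= a s IH; rewrite negb_and negbK => /orP[/mapP[y ys ay] | /IH[x [y [r [sr xy]]]]].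
  by exists a, y, (rem y s); rewrite perm_cons perm_to_rem.
exists x, y, (a :: r); split=> //; rewrite -(perm_cons a) in sr.
apply: perm_trans sr _; exact/permPl/(perm_catCA [:: a] [:: x; y]).
Qed.

(** Minimal representations with equal sums have equally many terms, so if the class of [x0]
    exhausts [s], it exhausts [t] as well. *)
Lemma class_split (c : algC -> algC) s t x0 : minrep s -> minrep t -> x0 \in s ->
  (forall y, \sum_(x <- s | c x == y) x = \sum_(x <- t | c x == y) x) ->
  size s = size t ->
  (exists P, [/\ \sum_(x <- s | P x) x = \sum_(x <- t | P x) x,
                 (0 < count P s)%N & (count P s < size s)%N]) \/
  forall x, x \in s ++ t -> c x = c x0.
Proof.
move=> s_min t_min x0s cst sst; pose P := [pred x | c x == c x0].
have P0 : (0 < count P s)%N by rewrite -has_count; apply/hasP; exists x0 => /=.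
have [ltP | ] := ltnP (count P s) (size s); first by left; exists P; split=> //; apply: cst.
move=> /(conj (count_size P s)) /andP; rewrite -eqn_leq => /eqP szP; right=> x.
have cP := minrep_count s_min t_min (cst (c x0)).
have aS : all P s by rewrite all_count szP.
have aT : all P t by rewrite all_count -/P -cP -sst szP.
by rewrite mem_cat => /orP[/(allP aS) | /(allP aT)] /eqP.
Qed.

(** Both [z] and [z - 1] lie on the unit circle, where conjugation is inversion; this forces z^2 - z
    + 1 = 0. *)
Lemma sixth_root (z : algC) :
  root_of_unity z -> root_of_unity (z - 1) -> 6.-primitive_root z /\ z - 1 = z ^+ 2.
Proof.
move=> zU z1U; have z0 := root_of_unity_neq0 zU; have z10 := root_of_unity_neq0 z1U.
have e : z ^+ 2 - z + 1 = 0.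
  have := mulfV z10; rewrite -(root_of_unity_conj z1U) rmorphB rmorph1 /=.
  rewrite (root_of_unity_conj zU) mulrBr mulr1 mulrBl mulfV // mul1r.
  move=> /(congr1 (fun u => - z * u)).
  have -> : - z * (1 - z^-1 - (z - 1)) = z ^+ 2 - z - z + z * z^-1 by ring.
  by rewrite mulfV // mulr1 => /eqP; rewrite -addr_eq0 => /eqP <-; ring.
have z2 : z ^+ 2 = z - 1 by rewrite -[LHS]subr0 -e; ring.
have z3 : z ^+ 3 = -1 by rewrite exprSr z2 mulrBl mul1r -expr2 z2; ring.
split=> //; apply/andP; split=> //; apply/forallP => -[[|[|[|[|[|[|//]]]]]] i6];
  rewrite unity_rootE /=; apply/eqP.
- apply/negP; rewrite expr1 => /eqP z1.
  by move/eqP: e; rewrite z1 expr1n subrr add0r oner_eq0.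
- apply/negP; rewrite z2 => /eqP z1; have {}z1 : z = 2 by rewrite -[z](subrK 1) z1.
  by move/eqP: e; rewrite z1 (_ : _ - _ + _ = 3%:R) ?pnatr_eq0 //; ring.
- apply/negP; rewrite z3 -subr_eq0 (_ : _ - _ = - 2%:R) ?oppr_eq0 ?pnatr_eq0 //; ring.
- apply/negP; rewrite exprSr z3 mulN1r => /eqP z1; have {}z1 : z = -1 by rewrite -z1 opprK.
  by move/eqP: e; rewrite z1 (_ : _ - _ + _ = 3%:R) ?pnatr_eq0 //; ring.
- apply/negP; rewrite (_ : 5 = 3 + 2)%N // exprD z3 mulN1r z2 opprB => /eqP z1.
  have {}z1 : z = 0 by rewrite -[z](subKr 1) z1 subrr.
  by rewrite z1 eqxx in z0.
- by rewrite (exprM z 3 2) z3 sqrrN expr1n !eqxx.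
Qed.

(** Including 0 in the uniqueness test makes the exponents nonzero: the class of exponent 0 is the
    one occupied by [u * z]. *)
Definition heptagonal (s : seq algC) :=
  exists (u z w : algC) (a b c : nat),
    [/\ root_of_unity u, 6.-primitive_root z, 7.-primitive_root w,
        uniq [:: 0; a; b; c]%N && all (fun i => i < 7)%N [:: a; b; c] &
        perm_eq s [:: u * z; u * w ^+ a; u * w ^+ b; u * w ^+ c]].

(** * Unequal class sums for a prime greater than 5 *)

Section PrimeAtLeast7.

Variables (p : nat) (c : algC -> algC) (v : algC).
Hypotheses (p_pr : prime p) (p5 : (5 < p)%N) (v0 : v != 0).

Local Notation class_eq s t := (forall y, y ^+ p = 1 ->
  \sum_(x <- s | c x == y) x - \sum_(x <- t | c x == y) x = v * y).

Lemma classes_cover s t y : class_eq s t -> y ^+ p = 1 -> y \in map c s ++ map c t.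
Proof.
move=> st yp; have y0 : y != 0 by apply: expr_eq1_neq0 (prime_gt0 p_pr) yp.
rewrite mem_cat; apply/norP => -[ys yt]; move/eqP: (st y yp).
by rewrite !sum_class_notin // subrr eq_sym mulf_eq0 (negPf v0) (negPf y0).
Qed.

Lemma unity_roots_list : exists w : algC, exists2 Y : seq algC,
  [/\ p.-primitive_root w, uniq Y & size Y = p] & forall y, (y \in Y) = (y ^+ p == 1).
Proof.
have [w prw] := C_prim_root_exists (prime_gt0 p_pr).
exists w, [seq w ^+ i | i <- iota 0 p]; last first.
  move=> y; apply/mapP/eqP => [[i _ ->] | yp].
    by rewrite -exprM mulnC exprM (prim_expr_order prw) expr1n.
  by have [i ->] := prim_rootP prw yp; exists (val i); rewrite // mem_iota add0n /=.
split; rewrite ?size_map ?size_iota // map_inj_in_uniq ?iota_uniq //.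
move=> i j; rewrite !mem_iota !add0n => ip jp /eqP.
by rewrite (eq_prim_root_expr prw) !modn_small // => /eqP.
Qed.

Lemma classes_size s t : (size s + size t <= 8)%N -> size s = size t ->
  class_eq s t -> p = 7%N /\ size s = 4%N.
Proof.
move=> st8 sst st; have [w [Y [prw uY sY] memY]] := unity_roots_list.
have : (p <= size s + size t)%N.
  rewrite -sY -(size_map c s) -(size_map c t) -size_cat uniq_leq_size // => y.
  by rewrite memY => /eqP; apply: classes_cover st.
move=> pst; have : p = 6%N \/ p = 7%N \/ p = 8%N by lia.
by case=> [p6|[p7|p8]]; [have := p_pr; rewrite p6|lia|have := p_pr; rewrite p8].
Qed.

(** Eight terms meet all seven classes, so if two terms of [s] share a class, every other class
    holds a single term. A single term [h] of [t] gives [- h = v * c h], so v is a root of unity.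
    The two terms in the shared class then add up to a root of unity, contradicting minimality. *)
Lemma classes_uniq s t : minrep s -> size s = 4%N -> size t = 4%N -> p = 7%N ->
  (forall x, x \in s ++ t -> root_of_unity x /\ c x ^+ p = 1) ->
  class_eq s t -> uniq (map c s).
Proof.
move=> s_min s4 t4 p7 stU st; apply: contraT => /not_uniq_map[x1 [x2 [r [sr x12]]]].
have [w [Y [prw uY sY] memY]] := unity_roots_list.
have r2 : size r = 2%N by have := perm_size sr; rewrite s4 => -[].
pose L := map c (x1 :: r) ++ map c t.
have YL : {subset Y <= L}.
  move=> y; rewrite memY => /eqP /(classes_cover st).
  rewrite /L !mem_cat (perm_mem (perm_map c sr)) /= !inE x12.
  by rewrite orbA orbb.
have uL : uniq L.
  by apply: leq_size_uniq uY YL _; rewrite sY size_cat !size_map /= r2 t4 p7.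
have {uL} [/andP[x1r ur] x1t ut] : [/\ uniq (c x1 :: map c r),
   {in map c t, forall y, y \notin map c (x1 :: r)} & uniq (map c t)].
  move: uL; rewrite /L cat_uniq => /and3P[-> /hasPn no ->]; split=> //.
case: t t4 stU st x1t ut {YL L} => [|h t] // [t3] stU st x1t ut.
have memh : h \in s ++ h :: t by rewrite mem_cat inE eqxx orbT.
have memx x : x \in [:: x1, x2 & r] -> x \in s ++ h :: t.
  by rewrite -(perm_mem sr) mem_cat => ->.
have [x1U cx1] := stU _ (memx _ (mem_head _ _)).
have [hU ch] := stU _ memh.
have e1 := st _ cx1; have e2 := st _ ch.
have nh : c h \notin map c [:: x1, x2 & r].
  have := x1t (c h) (mem_head _ _); rewrite /= !inE -x12 => /norP[h1 h2].
  by rewrite !negb_or h1 h2.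
have S2 : \sum_(x <- s | c x == c h) x = 0 by rewrite (perm_big _ sr) sum_class_notin.
move: e2; rewrite S2 sum_class_uniq ?mem_head // sub0r => e2.
have n1 : c x1 \notin map c (h :: t).
  by apply/negP => /x1t; rewrite mem_head.
have S1 : \sum_(x <- s | c x == c x1) x = x1 + x2.
  by rewrite (perm_big _ sr) !big_cons /= -x12 eqxx sum_class_notin // addr0.
move: e1; rewrite S1 sum_class_notin // subr0 => e1.
have c0 : c h != 0 by apply: expr_eq1_neq0 (prime_gt0 p_pr) ch.
have Dx : x1 + x2 = - h * (c x1 / c h) by rewrite e1 e2; field.
have cU x : c x ^+ p = 1 -> root_of_unity (c x).
  by move=> cx; apply/root_of_unityP; exists p; rewrite ?prime_gt0.
have /= := (minrep_perm sr s_min).2 ((x1 + x2) :: r).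
rewrite !big_cons addrA ltnn; apply=> // x; rewrite inE => /orP[/eqP-> | xr].
  rewrite Dx; apply: root_of_unityM; first exact: root_of_unityN.
  by apply: root_of_unityM; [apply: cU | apply/root_of_unityV/cU].
by apply: (stU x (memx x _)).1; rewrite !inE xr !orbT.
Qed.

End PrimeAtLeast7.

(** Neither list repeats a class, so exactly one class is met twice, by some [x0] in [s] and [x0']
    in [t]. The six other classes hold one term each, which is plus or minus v times a seventh root
    of unity. In the shared class [x0 - x0'] is a root of unity u, and z = x0 / u falls under
    [sixth_root]. *)
Lemma classes_heptagonal p c v s t : prime p -> (5 < p)%N -> v != 0 ->
  minrep s -> minrep t -> (size s <= 4)%N -> size s = size t ->
  (forall x, x \in s ++ t -> c x ^+ p = 1) ->
  (forall y, y ^+ p = 1 ->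
    \sum_(x <- s | c x == y) x - \sum_(x <- t | c x == y) x = v * y) ->
  heptagonal s /\ near 42 (s ++ t).
Proof.
move=> p_pr p5 v0 s_min t_min s4 sst stc st.
have [|p7 {}s4] := classes_size p_pr p5 v0 _ sst st; first by rewrite -sst; lia.
have t4 : size t = 4%N by rewrite -sst.
have stU x : x \in s ++ t -> root_of_unity x /\ c x ^+ p = 1.
  move=> xst; split; last exact: stc.
  by move: xst; rewrite mem_cat => /orP[/s_min.1|/t_min.1].
have us := classes_uniq p_pr v0 s_min s4 t4 p7 stU st.
have ut : uniq (map c t).
  apply: (classes_uniq p_pr (_ : - v != 0) t_min t4 s4 p7) => [|x|y yp].
  - by rewrite oppr_eq0.
  - by rewrite mem_cat orbC -mem_cat; apply: stU.
  - by rewrite mulNr -st // opprB.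
have [w [Y [prw uY sY] memY]] := unity_roots_list p_pr.
have [x0 [x0' [x0s x0t c0]]] : exists x y, [/\ x \in s, y \in t & c x = c y].
  have /hasP[y /mapP[y' y't ->] /mapP[x xs xy]] : has (mem (map c s)) (map c t).
    apply: contraT => no; have : (size (map c s ++ map c t) <= size Y)%N.
      apply: uniq_leq_size => [|y]; first by rewrite cat_uniq us ut no.
      by rewrite memY -map_cat => /mapP[x xst ->]; rewrite stc.
    by rewrite size_cat !size_map s4 t4 sY p7.
  by exists x, y'.
pose s1 := rem x0 s; pose t1 := rem x0' t.
have ps : perm_eq s (x0 :: s1) by apply: perm_to_rem.
have pt : perm_eq t (x0' :: t1) by apply: perm_to_rem.
have s1_3 : size s1 = 3%N by rewrite size_rem // s4.
have t1_3 : size t1 = 3%N by rewrite size_rem // t4.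
have uL : uniq (c x0 :: map c s1 ++ map c t1).
  apply: leq_size_uniq uY _ _; last by rewrite /= size_cat !size_map s1_3 t1_3 sY p7.
  move=> y; rewrite memY => /eqP /(classes_cover p_pr v0 st).
  rewrite mem_cat (perm_mem (perm_map c ps)) (perm_mem (perm_map c pt)) /= !inE mem_cat -c0.
  by case: (y == c x0); rewrite ?orbT //= .
move: uL; rewrite /= mem_cat cat_uniq => /and4P[/norP[x0s1 x0t1] us1 /hasPn no ut1].
have s1U x : x \in s1 -> x \in s by rewrite (perm_mem ps) inE orbC => ->.
have t1U x : x \in t1 -> x \in t by rewrite (perm_mem pt) inE orbC => ->.
have Ds1 x : x \in s1 -> x = v * c x.
  move=> xs1; have xs := s1U x xs1.
  rewrite -st ?stc ?mem_cat ?xs // sum_class_uniq // sum_class_notin ?subr0 //.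
  rewrite (perm_mem (perm_map c pt)) inE -c0 negb_or.
  apply/andP; split; first by apply: contraNneq x0s1 => <-; exact: map_f.
  by apply/negP => /no; rewrite map_f.
have Dt1 x : x \in t1 -> - x = v * c x.
  move=> xt1; have xt := t1U x xt1.
  rewrite -st ?stc ?mem_cat ?xt ?orbT // (sum_class_uniq ut) // sum_class_notin ?sub0r //.
  rewrite (perm_mem (perm_map c ps)) inE negb_or.
  apply/andP; split; first by apply: contraNneq x0t1 => <-; exact: map_f.
  by apply: no; exact: map_f.
have e0 : x0 - x0' = v * c x0.
  have cx0 : c x0 ^+ p = 1 by rewrite stc // mem_cat x0s.
  by rewrite -st // (sum_class_uniq us) // c0 (sum_class_uniq ut).
have cU x : x \in s ++ t -> root_of_unity (c x).
  by move=> /stc cx; apply/root_of_unityP; exists p; rewrite ?prime_gt0.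
have vU : root_of_unity v.
  case: s1 s1_3 s1U Ds1 {ps us1 x0s1 no} => // x r _ s1U Ds1.
  have xs := s1U x (mem_head _ _); have Dx := Ds1 x (mem_head _ _).
  have cxU : root_of_unity (c x) by apply: cU; rewrite mem_cat xs.
  have -> : v = x / c x by rewrite {1}Dx mulfK ?root_of_unity_neq0.
  by apply: root_of_unityM; [apply: s_min.1 | apply: root_of_unityV].
have cx0U : root_of_unity (c x0) by apply: cU; rewrite mem_cat x0s.
pose u := v * c x0; have uU : root_of_unity u by apply: root_of_unityM.
have u0 := root_of_unity_neq0 uU; have cx0n := root_of_unity_neq0 cx0U.
have x0U := s_min.1 _ x0s; have x0'U := t_min.1 _ x0t.
pose z := x0 / u; have Dz : z - 1 = x0' / u.
  have -> : x0' = x0 - u by rewrite /u -e0; ring.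
  by rewrite /z mulrBl divff.
have [z6 z2] : 6.-primitive_root z /\ z - 1 = z ^+ 2.
  by apply: sixth_root; rewrite ?Dz; apply/root_of_unityM/root_of_unityV.
have Dx0 : x0 = u * z by rewrite mulrC divfK.
have Dx0' : x0' = u * z ^+ 2 by rewrite -z2 Dz mulrC divfK.
have cp y : y \in s ++ t -> (c y / c x0) ^+ 7 = 1.
  by move=> yst; rewrite -p7 exprMn exprVn (stc _ yst) (stc x0) ?mem_cat ?x0s // invr1 mulr1.
split; last first.
  apply: (near_common u0) => x; rewrite mem_cat (perm_mem ps) (perm_mem pt) !inE.
  have z42 k : (u * z ^+ k / u) ^+ 42 = 1.
    by rewrite mulrAC divff // mul1r exprAC (exprM z 6 7) (prim_expr_order z6) !expr1n.
  have vc y : y \in s ++ t -> (v * c y / u) ^+ 42 = 1.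
    move=> /cp cy; have -> : v * c y / u = c y / c x0.
      by rewrite /u; field; rewrite (root_of_unity_neq0 vU) cx0n.
    by rewrite (exprM _ 7 6) cy expr1n.
  case/orP=> /orP[/eqP-> | xr].
  - by rewrite Dx0; apply: (z42 1%N).
  - by rewrite (Ds1 _ xr) vc // mem_cat s1U.
  - by rewrite Dx0' z42.
  - have -> : x / u = - (v * c x / u) by rewrite -(Dt1 _ xr); ring.
    by rewrite exprNn vc ?mem_cat ?t1U ?orbT // mulr1 -signr_odd.
have prw7 : 7.-primitive_root w by rewrite -p7.
have Dc x : x \in s1 -> exists2 a, (0 < a < 7)%N & c x = c x0 * w ^+ a.
  move=> xs1; have := cp x; rewrite mem_cat s1U // => /(_ isT) /(prim_rootP prw7)[a Da].
  have Dcx : c x = c x0 * w ^+ a by rewrite -Da mulrC divfK.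
  exists (val a) => //; rewrite ltn_ord andbT lt0n; apply: contraNneq x0s1 => a0.
  by have <- : c x = c x0; [rewrite Dcx a0 mulr1 | exact: map_f].
case: s1 s1_3 ps x0s1 us1 no s1U Ds1 Dc => [|y1 [|y2 [|y3 []]]] // _ ps x0s1 us1 _ s1U Ds1 Dc.
have [a /andP[a0 a7] Da] := Dc y1 (mem_head _ _).
have [|b /andP[b0 b7] Db] := Dc y2; first by rewrite !inE eqxx orbT.
have [|d /andP[d0 d7] Dd] := Dc y3; first by rewrite !inE eqxx !orbT.
exists u, z, w, a, b, d; split=> //; last first.
  have -> : u * w ^+ a = y1 by rewrite [RHS]Ds1 ?mem_head // Da mulrA.
  have -> : u * w ^+ b = y2 by rewrite [RHS]Ds1 ?inE ?eqxx ?orbT // Db mulrA.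
  have -> : u * w ^+ d = y3 by rewrite [RHS]Ds1 ?inE ?eqxx ?orbT // Dd mulrA.
  by rewrite -Dx0.
rewrite /= a7 b7 d7 /= !inE !andbT !negb_or !(eq_sym 0%N) -!lt0n a0 b0 d0 /=.
move: us1; rewrite /= !inE !negb_or andbT => /andP[/andP[n12 n13] n23].
apply/andP; split; [apply/andP; split|].
- by apply: contraNneq n12 => ab; rewrite Da Db ab.
- by apply: contraNneq n13 => ab; rewrite Da Dd ab.
- by apply: contraNneq n23 => ab; rewrite Db Dd ab.
Qed.

Definition splits (s t : seq algC) := exists P : pred algC,
  [/\ \sum_(x <- s | P x) x = \sum_(x <- t | P x) x,
      (0 < count P s)%N & (count P s < size s)%N].

Lemma class_sum_div (c : algC -> algC) s (x0 y : algC) :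
  \sum_(x <- [seq x / x0 | x <- s] | c x == y) x =
  (\sum_(x <- s | c (x / x0) == y) x) / x0.
Proof. by rewrite big_map mulr_suml. Qed.

Lemma class_sum_div_eq (c : algC -> algC) s t (x0 y : algC) : x0 != 0 ->
  \sum_(x <- [seq x / x0 | x <- s] | c x == y) x =
  \sum_(x <- [seq x / x0 | x <- t] | c x == y) x ->
  \sum_(x <- s | c (x / x0) == y) x = \sum_(x <- t | c (x / x0) == y) x.
Proof.
rewrite !class_sum_div => x00 /(mulIf (_ : x0^-1 != 0)); apply.
by rewrite invr_eq0.
Qed.

(** * Removing primes from the order of the ratios *)

Section Reduction.

Variables (p q : nat) (s t : seq algC).
Hypotheses (p_pr : prime p) (q0 : (0 < q)%N) (s_min : minrep s) (t_min : minrep t).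
Hypotheses (st_sum : \sum_(x <- s) x = \sum_(x <- t) x) (s0 : (0 < size s)%N).
Hypothesis st_near : near (p * q) (s ++ t).

Let sst : size s = size t. Proof. exact: minrep_size. Qed.

Lemma reduce_dvd : (p %| q)%N -> splits s t \/ near q (s ++ t).
Proof.
move=> pq; have [x0 x0s] : exists x, x \in s.
  by case: (s) s0 => // x r _; exists x; rewrite mem_head.
have x0n := root_of_unity_neq0 (s_min.1 _ x0s).
have [| //|P|c1] := class_split s_min t_min x0s (c := fun x => (x / x0) ^+ q).
- move=> y; apply: (@class_sum_div_eq (fun x => x ^+ q)) => //.
  apply: (class_sum_dvd p_pr _ _ _ pq) => [x|].
    rewrite -map_cat => /mapP[z zst ->]; apply: st_near => //.
    by rewrite mem_cat x0s.
  by rewrite !big_map -!mulr_suml st_sum.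
- by left; apply: P.
- right; apply: (near_common x0n) => x /c1 ->.
  by rewrite divff // expr1n.
Qed.

Lemma reduce_coprime : coprime p q -> (5 < p)%N -> (size s <= 4)%N ->
  [\/ splits s t, near q (s ++ t) | heptagonal s /\ near 42 (s ++ t)].
Proof.
move=> pq p5 s4; have [x0 x0s] : exists x, x \in s.
  by case: (s) s0 => // x r _; exists x; rewrite mem_head.
have x0st : x0 \in s ++ t by rewrite mem_cat x0s.
have x0n := root_of_unity_neq0 (s_min.1 _ x0s).
pose e := chinese p q 1 0; pose c x := (x / x0) ^+ e.
have cp x : x \in s ++ t -> c x ^+ p = 1.
  move=> xst; have qe : (q %| e)%N by rewrite /dvdn (chinese_modr pq) mod0n.
  have /dvdnP[j Dj] := qe; rewrite /c Dj -exprM -mulnA [(q * p)%N]mulnC mulnC exprM.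
  by rewrite st_near ?expr1n.
have [v0 cv] : exists v, forall y, y ^+ p = 1 ->
    \sum_(x <- s | c x == y) x - \sum_(x <- t | c x == y) x = v * y.
  have [||v Dv] := class_sum_coprime (s := [seq x / x0 | x <- s])
      (t := [seq x / x0 | x <- t]) p_pr _ _ pq.
  - by move=> x; rewrite -map_cat => /mapP[z zst ->]; apply: st_near.
  - by rewrite !big_map -!mulr_suml st_sum.
  exists (v * x0) => y /Dv; rewrite -/e !(class_sum_div (fun x => x ^+ e)) -mulrBl.
  by move=> /(canRL (divfK x0n)) ->; rewrite mulrAC.
have [v00 | v0n] := eqVneq v0 0; last first.
  by constructor 3; apply: (classes_heptagonal p_pr p5 v0n s_min t_min s4 sst cp cv).
have [|//|P|c1] := class_split s_min t_min x0s (c := c).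
- move=> y; apply/eqP; rewrite -subr_eq0; apply/eqP.
  have [yp | yp] := eqVneq (y ^+ p) 1; first by rewrite cv // v00 mul0r.
  have no r : {subset r <= s ++ t} -> y \notin map c r.
    by move=> rst; apply: contra yp => /mapP[x xr ->]; rewrite cp ?rst.
  by rewrite !sum_class_notin ?subr0 // no // => x; rewrite mem_cat => ->; rewrite ?orbT.
- by constructor 1; apply: P.
- constructor 2; apply: (near_common x0n) => x xst.
  have xe : (x / x0) ^+ e = 1 by rewrite -/(c x) c1 // /c divff // expr1n.
  have xpq : (x / x0) ^+ (p * q) = 1 by apply: st_near.
  have ep : e = 1 %[mod p] by rewrite (chinese_modl pq).
  (* As e = 1 modulo p, the p-th root of unity [(x / x0) ^+ q] equals its own e-th power, and the
     e-th power of [x / x0] is 1. *)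
  rewrite -[(_ / _) ^+ q]expr1.
  have xq : (x / x0) ^+ q ^+ p = 1 by rewrite -exprM mulnC.
  by rewrite (expr_eqmod xq (esym ep)) exprAC xe expr1n.
Qed.

End Reduction.

Lemma dvdn30 N : (0 < N)%N ->
  (forall p, prime p -> (p %| N)%N -> ~~ (p ^ 2 %| N)%N /\ (p <= 5)%N) -> (N %| 30)%N.
Proof.
move=> N0 H; apply/dvdn_partP => // p; rewrite mem_primes => /and3P[p_pr _ pN].
have [sq p5] := H p p_pr pN.
have -> : (N`_p)%N = p.
  rewrite p_part; suff -> : logn p N = 1%N by rewrite expn1.
  apply/eqP; rewrite eqn_leq -pfactor_dvdn // expn1 pN andbT.
  by rewrite leqNgt -pfactor_dvdn.
by move: p_pr p5 {pN sq H}; case: p => [|[|[|[|[|[|]]]]]].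
Qed.

(** Descent on N: unless N divides 30, some prime p either divides N twice or exceeds 5, and one of
    the two reductions replaces N by N / p or ends the descent. *)
Lemma trichotomy N s t : (0 < N)%N -> minrep s -> minrep t ->
  \sum_(x <- s) x = \sum_(x <- t) x -> (0 < size s <= 4)%N ->
  near N (s ++ t) ->
  [\/ splits s t, near 30 (s ++ t) | heptagonal s /\ near 42 (s ++ t)].
Proof.
move=> + s_min t_min st /andP[s0 s4].
have [n] := ubnP N; elim: n N => // n IH N Nn N0 stN.
have [/near_dvd/(_ stN) | N30] := boolP (N %| 30)%N; first by constructor 2.
suff [p [p_pr pN Hp]] : exists p, [/\ prime p, (p %| N)%N & ((p ^ 2 %| N) || (5 < p))%N].
  have /dvdnP[q DN] := pN; rewrite mulnC in DN.
  have q0 : (0 < q)%N by move: N0; rewrite DN muln_gt0 => /andP[].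
  have IHq : near q (s ++ t) ->
      [\/ splits s t, near 30 (s ++ t) | heptagonal s /\ near 42 (s ++ t)].
    apply: IH => //; rewrite ltnS in Nn; apply: leq_trans _ Nn.
    by rewrite DN -{1}[q]mul1n ltn_pmul2r ?prime_gt1.
  rewrite DN in stN; have [pq | pq] := boolP (p %| q)%N.
    by have [|] := reduce_dvd p_pr s_min t_min st s0 stN pq; [constructor 1 | apply: IHq].
  have p5 : (5 < p)%N.
    by move: Hp; rewrite DN expnS expn1 dvdn_pmul2l ?prime_gt0 // (negPf pq).
  rewrite -prime_coprime // in pq.
  by have [|/IHq|] := reduce_coprime p_pr s_min t_min st s0 stN pq p5 s4;
    [constructor 1 | | constructor 3].
have [p] : exists2 p, prime p & (p %| N)%N && ((p ^ 2 %| N) || (5 < p))%N.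
  have /allPn[p] : ~~ all (fun p => ~~ (p ^ 2 %| N)%N && (p <= 5)%N) (primes N).
    apply: contra N30 => /allP H; apply: dvdn30 => // p p_pr pN.
    by apply/andP/H; rewrite mem_primes p_pr N0.
  rewrite mem_primes => /and3P[p_pr _ pN] Hp; exists p => //.
  by rewrite pN /= ltnNge -[(_ ^ 2 %| _)%N]negbK -negb_and.
by move=> p_pr /andP[pN Hp]; exists p.
Qed.

Lemma common_exponent (s : seq algC) : (forall x, x \in s -> root_of_unity x) ->
  exists2 N, (0 < N)%N & forall x, x \in s -> x ^+ N = 1.
Proof.
elim: s => [|x s IH] sU; first by exists 1%N.
have [|N N0 sN] := IH; first by move=> y ys; apply: sU; rewrite inE ys orbT.
have /root_of_unityP[m m0 xm] := sU x (mem_head _ _).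
exists (m * N)%N => [|y]; first by rewrite muln_gt0 m0.
rewrite inE => /orP[/eqP-> | /sN yN]; first by rewrite exprM xm expr1n.
by rewrite mulnC exprM yN expr1n.
Qed.

Lemma minrep_near s t : minrep s -> minrep t -> exists2 N, (0 < N)%N & near N (s ++ t).
Proof.
move=> [sU _] [tU _]; have [|N N0 stN] := @common_exponent (s ++ t).
  by move=> x; rewrite mem_cat => /orP[/sU | /tU].
by exists N => // x y xs ys; rewrite exprMn exprVn !stN // invr1 mulr1.
Qed.

(** * Uniqueness of representations with at most four terms *)

Lemma splitsP s t : minrep s -> minrep t -> \sum_(x <- s) x = \sum_(x <- t) x ->
  splits s t -> exists s1 s2 t1 t2,
    [/\ [/\ perm_eq s (s1 ++ s2), perm_eq t (t1 ++ t2),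
            (0 < size s2)%N & (size s2 <= size s1)%N],
        [/\ minrep s1, minrep s2, minrep t1 & minrep t2],
        \sum_(x <- s1) x = \sum_(x <- t1) x & \sum_(x <- s2) x = \sum_(x <- t2) x].
Proof.
move=> s_min t_min st [P [eP P0 Ps]].
have key (Q : pred algC) r : perm_eq r (filter Q r ++ filter (predC Q) r).
  by rewrite perm_sym perm_filterC.
have eC : \sum_(x <- filter (predC P) s) x = \sum_(x <- filter (predC P) t) x.
  move: st; rewrite (perm_big _ (key P s)) (perm_big _ (key P t)) !big_cat /=.
  rewrite !(big_filter _ P) eP.
  exact: addrI.
have {}eP : \sum_(x <- filter P s) x = \sum_(x <- filter P t) x by rewrite !big_filter.
have C0 : (0 < count (predC P) s)%N.
  by rewrite -(count_predC P s) -[X in (X < _)%N]addn0 ltn_add2l in Ps.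
have [le | /ltnW le] := leqP (count (predC P) s) (count P s).
  exists (filter P s), (filter (predC P) s), (filter P t), (filter (predC P) t).
  by split=> //; split; rewrite ?size_filter //; apply: minrep_filter.
exists (filter (predC P) s), (filter P s), (filter (predC P) t), (filter P t).
by split=> //; split; rewrite ?size_filter //; try exact: minrep_filter;
   rewrite perm_sym perm_catC perm_sym.
Qed.

Lemma rep_unique_le3 s t : minrep s -> minrep t -> (size s <= 3)%N ->
  \sum_(x <- s) x = \sum_(x <- t) x -> perm_eq s t \/ near 30 (s ++ t).
Proof.
move=> s_min t_min s3 st.
have [|s2] := leqP (size s) 2; first by left; apply: minrep_uniq2.
have {s2 s3} s3 : size s = 3%N by apply/eqP; rewrite eqn_leq s3.
have [N N0 stN] := minrep_near s_min t_min.
have [|sp|n30|[hs _]] := trichotomy N0 s_min t_min st _ stN; first by rewrite s3.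
- have [s1 [s2 [t1 [t2 [[ps pt s20 s21] [s1m s2m t1m t2m] e1 e2]]]]] := splitsP s_min t_min st sp.
  have := perm_size ps; rewrite s3 size_cat => sz.
  have [z1 z2] : (size s1 <= 2)%N /\ (size s2 <= 2)%N.
    by move: sz s20 s21; move: (size s1) (size s2) => a b; lia.
  have p1 : perm_eq s1 t1 by apply: minrep_uniq2.
  have p2 : perm_eq s2 t2 by apply: minrep_uniq2.
  by left; rewrite (permPl ps) perm_sym (permPl pt) perm_sym perm_cat.
- by right.
- case: hs => u [z [w [a [b [c [_ _ _ _ /perm_size]]]]]].
  by rewrite s3.
Qed.

(** The last alternative arises from a splitting into three terms and one: the single term is common
    to both lists, while the triples may differ by a relation among 30th roots of unity. *)
Lemma rep_unique_4 s t : minrep s -> minrep t -> size s = 4%N ->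
  \sum_(x <- s) x = \sum_(x <- t) x ->
  [\/ perm_eq s t, near 30 (s ++ t), heptagonal s /\ near 42 (s ++ t) |
      exists e r r', [/\ perm_eq s (e :: r), perm_eq t (e :: r'),
                         size r = 3%N & near 30 (r ++ r')]].
Proof.
move=> s_min t_min s4 st.
have [N N0 stN] := minrep_near s_min t_min.
have [|sp|n30|hs] := trichotomy N0 s_min t_min st _ stN; first by rewrite s4.
- have [s1 [s2 [t1 [t2 [[ps pt s20 s21] [s1m s2m t1m t2m] e1 e2]]]]] := splitsP s_min t_min st sp.
  have := perm_size ps; rewrite s4 size_cat => sz.
  have [z1 z2 z3] : [/\ (size s1 <= 3)%N, (size s2 <= 2)%N &
      (2 < size s1)%N -> size s1 = 3%N /\ size s2 = 1%N].
    by move: sz s20 s21; move: (size s1) (size s2) => a b; split; lia.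
  have p2 : perm_eq s2 t2 by apply: minrep_uniq2.
  have [//|p1|n1] := rep_unique_le3 s1m t1m _ e1.
    by constructor 1; rewrite (permPl ps) perm_sym (permPl pt) perm_sym perm_cat.
  have [s12 | s12] := leqP (size s1) 2.
    have p1 : perm_eq s1 t1 by apply: minrep_uniq2.
    by constructor 1; rewrite (permPl ps) perm_sym (permPl pt) perm_sym perm_cat.
  have [s13 s2_1] := z3 s12.
  case: s2 s2_1 p2 ps {sz s20 s21 s2m e2 z2 z3} => [|e []] // _ p2 ps.
  have Dt2 : t2 = [:: e] by apply: perm_small_eq; rewrite // perm_sym.
  constructor 4; exists e, s1, t1; split=> //.
    by rewrite (permPl ps) perm_catC.
  by rewrite (permPl pt) Dt2 perm_catC.
- by constructor 2.
- by constructor 3.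
Qed.

(** * Reduction modulo a prime *)

(* Z[zeta] = Z[X] / Phi_n maps to any field containing a primitive n-th root of unity. *)
Lemma cyclotomic_specialize (F : fieldType) n (z : algC) (g : F) (P : {poly int}) :
  n.-primitive_root z -> n.-primitive_root g ->
  (map_poly intr P).[z] = 0 -> (map_poly intr P).[g] = 0.
Proof.
move=> prz prg Pz; have n0 := prim_order_gt0 prz.
have Phiz : (map_poly intr 'Phi_n).[z] = 0.
  by apply/rootP; rewrite (Cintr_Cyclotomic prz) root_cyclotomic.
have Phig : (map_poly intr 'Phi_n).[g] = 0.
  (* The element [g] is a root of X^n - 1, hence of the q-th cyclotomic polynomial for some divisor
     q of n; then g^q = 1, and primitivity gives q = n. *)
  have [q [q_n q0]] : exists d, (d %| n)%N /\ (map_poly intr 'Phi_d).[g] = 0.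
    have /eqP: (map_poly intr (\prod_(d <- divisors n) 'Phi_d)).[g] = 0.
      rewrite prod_Cyclotomic // rmorphB /= map_polyXn rmorph1 hornerD hornerN.
      by rewrite hornerXn hornerC prim_expr_order // subrr.
    rewrite rmorph_prod horner_prod prodf_seq_eq0 => /hasP[d].
    by rewrite -dvdn_divisors // => dn /andP[_ /eqP]; exists d.
  suff -> : n = q by [].
  apply/eqP; rewrite eqn_dvd q_n (prim_order_dvd prg) andbT -subr_eq0.
  have q0' : (0 < q)%N by apply: dvdn_gt0 q_n.
  have : (map_poly intr ('X^q - 1)).[g] = 0.
    rewrite -prod_Cyclotomic // (big_rem q) /=; last by rewrite -dvdn_divisors.
    by rewrite rmorphM hornerM q0 mul0r.
  by rewrite rmorphB /= map_polyXn rmorph1 hornerD hornerN hornerXn hornerC => ->.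
(* The remainder of [P] modulo the cyclotomic polynomial vanishes at [z] but has smaller degree than
   the minimal polynomial of [z], so it is zero. Division stays over the integers because the
   divisor is monic. *)
have DP := Pdiv.RingMonic.rdivp_eq (Cyclotomic_monic n) P.
set R := Pdiv.Ring.rmodp P _ in DP.
suff R0 : R = 0 by rewrite DP R0 addr0 rmorphM hornerM Phig mulr0.
have Rz : (map_poly intr R).[z] = 0.
  by move: Pz; rewrite DP rmorphD rmorphM hornerD hornerM Phiz mulr0 add0r.
apply: contraTeq isT => R_n0.
have [p [Dp p_mon] pP] := minCpolyP z.
have RQ : map_poly intr R = map_poly ratr (map_poly intr R : {poly rat}) :> {poly algC}.
  by rewrite -map_poly_comp; apply: eq_map_poly => c /=; rewrite ratr_int.
have pR : p %| (map_poly intr R : {poly rat}) by rewrite -pP -RQ; apply/rootP.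
have szR : size (map_poly intr R : {poly rat}) = size R.
  by apply: size_map_inj_poly => //; exact: intr_inj.
have := dvdp_leq _ pR; rewrite -size_poly_eq0 szR size_poly_eq0 R_n0 => /(_ isT).
have -> : size p = size 'Phi_n.
  by rewrite -(size_map_poly (@ratr algC) p) -Dp (minCpoly_cyclotomic prz)
    size_cyclotomic size_Cyclotomic.
by rewrite leqNgt Pdiv.Ring.ltn_rmodpN0 // monic_neq0 ?Cyclotomic_monic.
Qed.

Lemma cyclotomic_specialize_sum (F : fieldType) n (z : algC) (g : F) (s t : seq nat) k :
  n.-primitive_root z -> n.-primitive_root g ->
  (\sum_(i <- s) z ^+ i) ^+ k = (\sum_(i <- t) z ^+ i) ^+ k ->
  (\sum_(i <- s) g ^+ i) ^+ k = (\sum_(i <- t) g ^+ i) ^+ k.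
Proof.
move=> prz prg; pose P (r : seq nat) : {poly int} := (\sum_(i <- r) 'X^i) ^+ k.
have PE (A : comNzRingType) (x : A) r :
    (map_poly intr (P r)).[x] = (\sum_(i <- r) x ^+ i) ^+ k.
  rewrite rmorphXn rmorph_sum /= horner_exp horner_sum; congr (_ ^+ k).
  by apply: eq_bigr => i _; rewrite map_polyXn hornerXn.
move/eqP; rewrite -!PE -subr_eq0 -hornerN -hornerD -rmorphN -rmorphD => /eqP.
move/(cyclotomic_specialize prz prg)/eqP.
by rewrite rmorphD rmorphN hornerD hornerN subr_eq0 !PE => /eqP.
Qed.

(** * Computation in prime fields with binary integers *)

Section ModularArithmetic.

Variable q : BinNums.N.

Definition mulm (x y : BinNums.N) : BinNums.N := BinNat.N.modulo (BinNat.N.mul x y) q.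

Fixpoint powm (x : BinNums.N) (k : BinNums.positive) : BinNums.N :=
  match k with
  | BinNums.xH => x
  | BinNums.xO k => let y := powm x k in mulm y y
  | BinNums.xI k => let y := powm x k in mulm (mulm y y) x
  end.

Definition tabm (g : BinNums.N) (n : nat) : seq BinNums.N :=
  traject (mulm g) (BinNums.Npos BinNums.xH) n.

Definition summ (T : seq BinNums.N) (s : seq nat) : BinNums.N :=
  BinNat.N.modulo (foldr (fun i => BinNat.N.add (nth BinNums.N0 T i)) BinNums.N0 s) q.

Variable F : fieldType.
Hypothesis Fq : (BinNat.N.to_nat q)%:R = 0 :> F.
Hypothesis q0 : q <> BinNums.N0.

Definition toF (x : BinNums.N) : F := (BinNat.N.to_nat x)%:R.

Lemma toFD x y : toF (BinNat.N.add x y) = toF x + toF y.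
Proof. by rewrite /toF Nnat.N2Nat.inj_add plusE natrD. Qed.

Lemma toFM x y : toF (BinNat.N.mul x y) = toF x * toF y.
Proof. by rewrite /toF Nnat.N2Nat.inj_mul multE natrM. Qed.

Lemma toF_mod x : toF (BinNat.N.modulo x q) = toF x.
Proof. by rewrite [in RHS](BinNat.N.div_mod x q q0) toFD toFM {2}/toF Fq mul0r add0r. Qed.

Lemma toF_mulm x y : toF (mulm x y) = toF x * toF y.
Proof. by rewrite toF_mod toFM. Qed.

Lemma toF_powm x k : toF (powm x k) = toF x ^+ BinPos.Pos.to_nat k.
Proof.
elim: k => [k IH|k IH|]; last by rewrite expr1.
  by rewrite /= !toF_mulm IH Pnat.Pos2Nat.inj_xI multE exprS mulrC mulnC exprM.
by rewrite /= toF_mulm IH Pnat.Pos2Nat.inj_xO multE mulnC exprM.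
Qed.

Lemma toF_tabm g n i : (i < n)%N -> toF (nth BinNums.N0 (tabm g n) i) = toF g ^+ i.
Proof.
move=> i_n; rewrite /tabm (set_nth_default (BinNums.Npos BinNums.xH)) ?size_traject //.
rewrite nth_traject //; elim: i {i_n} => [|i IH]; first by rewrite expr0.
by rewrite iterS toF_mulm IH exprS.
Qed.

Lemma toF_summ g n s : all (gtn n) s ->
  toF (summ (tabm g n) s) = \sum_(i <- s) toF g ^+ i.
Proof.
rewrite /summ toF_mod; elim: s => [|i s IH] /=; first by rewrite big_nil.
by case/andP=> i_n /IH e; rewrite big_cons toFD e toF_tabm.
Qed.

End ModularArithmetic.

Lemma nat_modE a b : (0 < b)%N -> Nat.modulo a b = (a %% b)%N.
Proof.
move=> b0; symmetry; apply: (PeanoNat.Nat.mod_unique _ _ (a %/ b)%N).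
  exact/ssrnat.ltP/ltn_pmod.
by rewrite multE plusE mulnC; apply: divn_eq.
Qed.

Lemma toF_inj p q x y : prime p -> BinNat.N.to_nat q = p ->
  toF 'F_p x = toF 'F_p y -> BinNat.N.modulo x q = BinNat.N.modulo y q.
Proof.
move=> p_pr qp /(congr1 (fun u : 'F_p => nat_of_ord u)); rewrite /toF !val_Fp_nat // => xy.
have q0 : q <> BinNums.N0 by move=> q0; rewrite -qp q0 in p_pr.
apply: Nnat.N2Nat.inj; rewrite !Nnat.N2Nat.inj_mod // qp !nat_modE ?prime_gt0 //.
Qed.

Lemma toF_modulus p q : prime p -> BinNat.N.to_nat q = p ->
  (BinNat.N.to_nat q)%:R = 0 :> 'F_p.
Proof. by move=> p_pr ->; apply/val_inj; rewrite /= val_Fp_nat // modnn. Qed.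

Lemma primitive_root_cofactors (F : fieldType) n (x : F) : (0 < n)%N -> x ^+ n = 1 ->
  (forall p, prime p -> (p %| n)%N -> x ^+ (n %/ p) != 1) -> n.-primitive_root x.
Proof.
move=> n0 xn H; have [k prk kn] := prim_order_exists n0 xn.
have [Dn | kn1] := eqVneq (n %/ k)%N 1%N.
  by rewrite -(divnK kn) Dn mul1n.
have q0 : (0 < n %/ k)%N by rewrite divn_gt0 ?(prim_order_gt0 prk) //; apply: dvdn_leq.
have p_pr : prime (pdiv (n %/ k)) by rewrite pdiv_prime // ltn_neqAle eq_sym kn1.
have /dvdnP[j Dj] := pdiv_dvd (n %/ k).
have Dn : n = (j * k * pdiv (n %/ k))%N by rewrite -{1}(divnK kn) {1}Dj mulnAC.
have pn : (pdiv (n %/ k) %| n)%N by rewrite {2}Dn dvdn_mull.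
case/eqP: (H _ p_pr pn).
by rewrite {1}Dn mulnK ?prime_gt0 // mulnC exprM (prim_expr_order prk) expr1n.
Qed.

(* Exponents of 30th roots of unity among which no two are opposite or differ
   by a cube root of unity, and no three lie on a pentagon; these are the ways a
   short sum of 30th roots of unity can fail to have minimal length. *)
Definition irreducible30 (e : seq nat) : bool :=
  pairwise (fun i j => all (fun d => (i + d) %% 30 != j) [:: 10; 15; 20])%N e &&
  all (fun y => size (undup [seq i <- e | i %% 6 == y]) < 3)%N (iota 0 6).

Definition sorted_pairs n := [seq [:: a; b] | b <- iota 0 n, a <- iota 0 b.+1].
Definition sorted_triples n :=
  [seq a :: r | r <- sorted_pairs n, a <- iota 0 (head 0%N r).+1].

Definition multiples_of (k : nat) := all (fun i => k %| i)%N.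

(* 450 has order 30 modulo the prime 5881, and 79 has order 42 modulo the prime 1471;
   these primes are large enough to separate the sums compared below. *)
Definition q30 := Eval compute in bin_of_nat 5881.
Definition g30 := Eval compute in bin_of_nat 450.
Definition k30 := Eval compute in BinPos.Pos.of_nat 30.
Definition pow30 T s := BinNat.N.modulo (powm q30 (summ q30 T s) k30) q30.

(** The unit 7 is 1 modulo 6 and generates the units modulo 5. Exponents that are all multiples of 3
    or all multiples of 5 are exempt: the terms are then 10th or 6th roots of unity up to rotation,
    where the group of units has at most four elements. *)
Definition check30 T (r : seq nat) : bool :=
  let e := 0%N :: r in
  irreducible30 e ==> ~~ multiples_of 3 e ==> ~~ multiples_of 5 e ==>
  ~~ BinNat.N.eqb (pow30 T [seq (7 * i) %% 30 | i <- e]%N) (pow30 T e).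

Lemma check30_sorted : let T := tabm q30 g30 30 in
  all (check30 T) (sorted_pairs 30) && all (check30 T) (sorted_triples 30).
Proof. by vm_compute. Qed.

Definition q42 := Eval compute in bin_of_nat 1471.
Definition g42 := Eval compute in bin_of_nat 79.
Definition k42 := Eval compute in BinPos.Pos.of_nat 42.
Definition pow42 T s := BinNat.N.modulo (powm q42 (summ q42 T s) k42) q42.
(* For z of order 6 and w of order 7, y = z * w satisfies z = y ^+ 7 and w = y ^+ 36. *)
Definition heptexp (a b c : nat) : seq nat :=
  [seq i %% 42 | i <- [:: 7; 36 * a; 36 * b; 36 * c]]%N.

Definition conj42 T k e := BinNat.N.eqb (pow42 T [seq (k * i) %% 42 | i <- e]%N) (pow42 T e).

Definition residues (s : seq nat) := perm_eq s [:: 1; 2; 4]%N || perm_eq s [:: 3; 5; 6]%N.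

(** The listed units are those on which the quadratic characters modulo 3 and modulo 7 disagree. The
    six units left form a subgroup, generated by 37, which is 1 modulo 6 and 2 modulo 7, and 41,
    which is -1. *)
Lemma check42 : let T := tabm q42 g42 42 in let I := iota 1 6 in
  all (fun a => all (fun b => all (fun c => uniq [:: a; b; c] ==>
    all (fun k => ~~ conj42 T k (heptexp a b c)) [:: 11; 13; 19; 23; 29; 31]%N &&
    (conj42 T 37 (heptexp a b c) ==> residues [:: a; b; c])) I) I) I.
Proof. by vm_compute. Qed.

Lemma prime5881 : prime 5881. Proof. by vm_compute. Qed.
Lemma prime1471 : prime 1471. Proof. by vm_compute. Qed.

Lemma primitive_powm p q x n : prime p -> BinNat.N.to_nat q = p -> (0 < n)%N ->
  let c k := BinNat.N.modulo (powm q x (BinPos.Pos.of_nat k)) q in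
  let o := BinNat.N.modulo (BinNums.Npos BinNums.xH) q in
  c n = o ->
  all (fun l => prime l ==> (l %| n) ==> ~~ BinNat.N.eqb (c (n %/ l)) o)%N (iota 0 n.+1) ->
  n.-primitive_root (toF 'F_p x).
Proof.
move=> p_pr qp n0 c o cn ck.
have Fq := toF_modulus p_pr qp.
have q0 : q <> BinNums.N0 by move=> q0; rewrite -qp q0 in p_pr.
have toF1 : toF 'F_p (BinNums.Npos BinNums.xH) = 1 by [].
have powE k : (0 < k)%N -> toF 'F_p (c k) = toF 'F_p x ^+ k.
  move=> k0; rewrite /c (toF_mod Fq q0) (toF_powm Fq q0).
  by rewrite Pnat.Nat2Pos.id //; case: k k0.
apply: primitive_root_cofactors => // [|l l_pr l_n].
  by rewrite -powE // cn (toF_mod Fq q0).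
have l_n1 : (l < n.+1)%N by rewrite ltnS dvdn_leq.
have := allP ck l; rewrite mem_iota /= add0n l_n1 l_pr l_n => /(_ isT).
have nl0 : (0 < n %/ l)%N by rewrite divn_gt0 ?prime_gt0 // dvdn_leq.
apply: contraNneq => xl; rewrite -powE // in xl.
have := toF_inj p_pr qp (etrans xl (esym toF1)); rewrite {1}/c BinNat.N.mod_mod // => cl.
by apply/BinNat.N.eqb_eq; rewrite /c cl.
Qed.

Lemma prim30 : 30.-primitive_root (toF 'F_5881 g30).
Proof. by apply: (primitive_powm (q := q30) prime5881); vm_compute. Qed.

Lemma prim42 : 42.-primitive_root (toF 'F_1471 g42).
Proof. by apply: (primitive_powm (q := q42) prime1471); vm_compute. Qed.

Lemma pow_summ_eq p q x (n : nat) k (z : algC) (s t : seq nat) :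
  prime p -> BinNat.N.to_nat q = p -> n.-primitive_root (toF 'F_p x) ->
  n.-primitive_root z -> all (gtn n) s -> all (gtn n) t ->
  (\sum_(i <- s) z ^+ i) ^+ BinPos.Pos.to_nat k =
  (\sum_(i <- t) z ^+ i) ^+ BinPos.Pos.to_nat k ->
  BinNat.N.modulo (powm q (summ q (tabm q x n) s) k) q =
  BinNat.N.modulo (powm q (summ q (tabm q x n) t) k) q.
Proof.
move=> p_pr qp prx prz sn tn /(cyclotomic_specialize_sum prz prx) e.
have Fq := toF_modulus p_pr qp.
have q0 : q <> BinNums.N0 by move=> q0; rewrite -qp q0 in p_pr.
by apply: (toF_inj p_pr qp); rewrite !(toF_powm Fq q0) !(toF_summ Fq q0).
Qed.

Lemma sum_expr_mod n (z : algC) k (e : seq nat) : n.-primitive_root z ->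
  \sum_(i <- [seq (k * i) %% n | i <- e]%N) z ^+ i = \sum_(i <- e) z ^+ (k * i).
Proof.
by move=> prz; rewrite big_map; apply: eq_bigr => i _; rewrite prim_expr_mod.
Qed.

Lemma check30_sum (z : algC) (r : seq nat) :
  30.-primitive_root z -> sorted leq r -> all (gtn 30) r ->
  (size r == 2) || (size r == 3) -> irreducible30 (0%N :: r) ->
  ~~ multiples_of 3 (0%N :: r) -> ~~ multiples_of 5 (0%N :: r) ->
  (\sum_(i <- 0%N :: r) z ^+ (7 * i)) ^+ 30 <> (\sum_(i <- 0%N :: r) z ^+ i) ^+ 30.
Proof.
move=> prz sr r30 sz irr m3 m5 eqS.
have ck : check30 (tabm q30 g30 30) r.
  have /andP[/allP ck2 /allP ck3] := check30_sorted.
  have pairsP a b : (a <= b)%N -> (b < 30)%N -> [:: a; b] \in sorted_pairs 30.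
    by move=> ab b30; apply/allpairsPdep; exists b, a; rewrite !mem_iota /= !add0n ltnS.
  case: r sr r30 sz {irr m3 m5 eqS} => [|a [|b [|c []]]] //=.
    by rewrite andbT => ab /and3P[_ b30 _] _; apply/ck2/pairsP.
  move=> /and3P[ab bc _] /and4P[_ _ c30 _] _; apply: ck3.
  apply/allpairsPdep; exists [:: b; c], a; split=> //; first exact: pairsP.
  by rewrite mem_iota add0n ltnS.
move: ck; rewrite /check30 irr m3 m5 !implyTb => /negP; apply.
apply/BinNat.N.eqb_eq; apply: (pow_summ_eq prime5881 _ prim30 prz) => //.
  by apply/allP => _ /mapP[i _ ->]; rewrite /= ltn_mod.
have -> : BinPos.Pos.to_nat k30 = 30%N by [].
by rewrite sum_expr_mod.
Qed.

Lemma check42_sum (z : algC) a b c k :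
  42.-primitive_root z -> all (fun i => 0 < i < 7)%N [:: a; b; c] -> uniq [:: a; b; c] ->
  (\sum_(i <- heptexp a b c) z ^+ (k * i)) ^+ 42 = (\sum_(i <- heptexp a b c) z ^+ i) ^+ 42 ->
  k \notin [:: 11; 13; 19; 23; 29; 31]%N /\ (k = 37%N -> residues [:: a; b; c]).
Proof.
move=> prz /and4P[a7 b7 c7 _] u eqS.
have I6 i : (0 < i < 7)%N -> i \in iota 1 6 by rewrite mem_iota.
have := allP (allP (allP check42 a (I6 a a7)) b (I6 b b7)) c (I6 c c7).
rewrite u implyTb => /andP[/allP ck /implyP ck37].
have T : conj42 (tabm q42 g42 42) k (heptexp a b c).
  apply/BinNat.N.eqb_eq; apply: (pow_summ_eq prime1471 _ prim42 prz) => //.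
  - by apply/allP => _ /mapP[i _ ->]; rewrite /= ltn_mod.
  - by apply/allP => _ /mapP[i _ ->]; rewrite /= ltn_mod.
  have -> : BinPos.Pos.to_nat k42 = 42%N by [].
  by rewrite sum_expr_mod.
split=> [|Dk]; last by move: T; rewrite Dk; apply: ck37.
by apply/negP => /ck; rewrite T.
Qed.

(** * Stabilizers *)

Lemma index_le_size (gT : finGroupType) (T : eqType) (H K : {group gT})
    (f : gT -> T) (L : seq T) :
  {in H, forall u, f u \in L} ->
  {in H &, forall u v, f u = f v -> (u * v^-1)%g \in K} -> (#|H : K|%g <= size L)%N.
Proof.
move=> fL fK; pose h (C : {set gT}) := odflt 1%g [pick u in H | C == (K :* u)%g].
have hP C : C \in rcosets K H -> h C \in H /\ C = (K :* h C)%g.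
  move=> /rcosetsP[u uH ->]; rewrite /h; case: pickP => [v /andP[vH /eqP] //|/(_ u)].
  by rewrite uH eqxx.
have : (size (map (f \o h) (enum (rcosets K H))) <= size L)%N.
  apply: uniq_leq_size; last first.
    by move=> y /mapP[C]; rewrite mem_enum => /hP[hC _] -> /=; apply: fL.
  rewrite map_inj_in_uniq ?enum_uniq // => C D; rewrite !mem_enum.
  move=> /hP[hC DC] /hP[hD DD] /= fCD; rewrite DC DD.
  by apply/rcoset_eqP; rewrite mem_rcoset fK.
by rewrite size_map -cardE.
Qed.

Section Stabilizers.

Variable m : nat.
Local Notation M := m.+2.
Local Notation G := {unit 'I_M}.
Implicit Types (H K : {group G}) (u v : G).

Lemma unit_commute u v : (u * v = v * u)%g. Proof. exact: unit_Zp_mulgC. Qed.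

Lemma Q_sub_unity x : x ^+ M = 1 -> Q_sub x (cyc_gen M).
Proof.
move=> xM; have [i ->] := prim_rootP (cyc_genP (ltn0Sn m.+1)) xM.
by apply/Q_subP; exists 'X^i; rewrite map_polyXn hornerXn.
Qed.

Lemma Q_sub_sum N (s : seq algC) : (0 < N)%N -> (forall x, x \in s -> x ^+ N = 1) ->
  Q_sub (\sum_(x <- s) x) (cyc_gen N).
Proof.
move=> N0; elim: s => [|x s IH] sN; apply/Q_subP.
  by exists 0; rewrite big_nil rmorph0 horner0.
have /Q_subP[p Dp] := IH (fun y ys => sN y (mem_behead (s := x :: s) ys)).
have [i Di] := prim_rootP (cyc_genP N0) (sN x (mem_head _ _)).
exists ('X^i + p); rewrite big_cons Dp Di rmorphD /= map_polyXn.
by rewrite hornerD hornerXn.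
Qed.

Lemma cycautK u x : x ^+ M = 1 -> cycaut u^-1 (cycaut u x) = x.
Proof.
move=> xM; rewrite -cycautM ?Q_sub_unity // mulVg.
exact/cycaut1/Q_sub_unity.
Qed.

Definition fixes (s : seq algC) : {set G} := [set u | all (fun x => cycaut u x == x) s].

Lemma fixesP s u : reflect {in s, forall x, cycaut u x = x} (u \in fixes s).
Proof. by rewrite inE; apply: (iffP allP) => H x /H /eqP. Qed.

Lemma fixes_group s : (forall x, x \in s -> x ^+ M = 1) ->
  {K : {group G} | K = fixes s :> {set G}}.
Proof.
move=> sM; have gF : group_set (fixes s).
  apply/group_setP; split.
    by apply/fixesP => x xs; apply/cycaut1/Q_sub_unity/sM.
  move=> u v /fixesP us /fixesP vs; apply/fixesP => x xs.
  by rewrite cycautM ?Q_sub_unity ?sM // vs // us.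
by exists (Group gF).
Qed.

Lemma fixes_cat s t : fixes (s ++ t) = fixes s :&: fixes t.
Proof. by apply/setP=> u; rewrite !inE all_cat. Qed.

Lemma index_fixes1_le H x L : x ^+ M = 1 -> {in H, forall u, cycaut u x \in L} ->
  (#|H : H :&: fixes [:: x]|%g <= size L)%N.
Proof.
move=> xM HL; have [|K DK] := @fixes_group [:: x]; first by move=> y; rewrite inE => /eqP->.
rewrite -DK indexgI; apply: (index_le_size (f := fun u => cycaut u x)) => // u v _ _ uv.
rewrite DK inE /= andbT unit_commute cycautM ?Q_sub_unity //.
by rewrite uv cycautK.
Qed.

(** As the group is abelian, an element fixing x fixes its whole orbit. The index is therefore at
    most the length of this orbit times the index for the remaining terms, and for at most four
    terms such a product does not exceed the number of terms. With five terms, orbits of lengths 2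
    and 3 would already allow 6. *)
Lemma index_permuted_le H (s : seq algC) : (forall x, x \in s -> x ^+ M = 1) ->
  {in H, forall u, perm_eq (map (cycaut u) s) s} -> (size s <= 4)%N ->
  (#|H : H :&: fixes s|%g <= maxn 1 (size s))%N.
Proof.
have [n] := ubnP (size s); elim: n H s => // n IH H s sn sM Hs s4.
case Ds: s => [|x s'].
  rewrite (_ : H :&: _ = H) ?indexgg //.
  by apply/setIidPl/subsetP => u _; rewrite inE.
rewrite -Ds; have xs : x \in s by rewrite Ds mem_head.
have xM := sM x xs.
pose orb := [seq cycaut u x | u in H].
pose P y := y \in orb; pose L := filter P s; pose s1 := filter (predC P) s.
have szs : (size L + size s1 = size s)%N by rewrite !size_filter count_predC.
have L0 : (0 < size L)%N.
  rewrite size_filter -has_count; apply/hasP; exists x => //.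
  by apply/imageP; exists 1%g; rewrite // cycaut1 ?Q_sub_unity.
have s1s : {subset s1 <= s} by move=> y; rewrite mem_filter => /andP[].
have [K1 DK1] := @fixes_group s1 (fun y ys => sM y (s1s y ys)).
have [Kx DKx] : {K : {group G} | K = fixes [:: x] :> {set G}}.
  by apply: fixes_group => y; rewrite inE => /eqP->.
have [Ks DKs] := fixes_group sM.
have H1s1 : {in (H :&: Kx)%G, forall u, perm_eq (map (cycaut u) s1) s1}.
  move=> u /setIP[uH _]; rewrite /s1.
  have -> : map (cycaut u) (filter (predC P) s) = filter (predC P) (map (cycaut u) s).
    rewrite filter_map; congr map; apply: eq_in_filter => y ys /=; congr (~~ _).
    apply/imageP/imageP => -[v vH]; [move=> -> | move=> uy].
      by exists (u * v)%g; rewrite ?groupM // cycautM ?Q_sub_unity.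
    exists (u^-1 * v)%g; first by rewrite groupM ?groupV.
    by rewrite cycautM ?Q_sub_unity // -uy cycautK ?sM.
  exact/perm_filter/Hs.
have IH1 : (#|(H :&: Kx)%G : (H :&: Kx)%G :&: fixes s1|%g <= maxn 1 (size s1))%N.
  have s1lt : (size s1 < size s)%N by rewrite -szs -[X in (X < _)%N]add0n ltn_add2r.
  apply: IH => // [|y /s1s /sM //|]; first by apply: leq_trans s1lt _.
  exact: leq_trans (ltnW s1lt) s4.
have HL : (#|H : (H :&: Kx)%G|%g <= size L)%N.
  rewrite /= DKx; apply: index_fixes1_le => // u uH; rewrite mem_filter.
  apply/andP; split; first by apply/imageP; exists u.
  by rewrite -(perm_mem (Hs u uH)) map_f.
have sub : ((H :&: Kx) :&: K1)%G \subset (H :&: Ks)%G.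
  apply/subsetP => w /setIP[/setIP[wH]]; rewrite DKx DK1 => /fixesP wx /fixesP w1.
  rewrite inE wH DKs; apply/fixesP => y ys.
  have [/imageP[v vH ->] | yP] := boolP (P y); last by apply: w1; rewrite mem_filter /= yP.
  by rewrite -cycautM ?Q_sub_unity // unit_commute cycautM ?Q_sub_unity // wx ?mem_head.
rewrite -DKs; apply: leq_trans (dvdn_leq (indexg_gt0 _ _) (indexgS H sub)) _.
rewrite -(Lagrange_index (subsetIl H Kx) (subsetIl (H :&: Kx)%G K1)) /=.
rewrite -DK1 /= in IH1; apply: leq_trans (leq_mul HL IH1) _.
move: szs L0 s4; move: (size L) (size s1) (size s) => a b c <-.
by case: a => [|[|[|[|[|a]]]]] // _ ab; lia.
Qed.

Section Reduction.

Variable d : nat.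
Local Notation D := d.+2.
Hypothesis DM : (D %| M)%N.

Lemma unit_Zp_coprime_dvd u : coprime (val u) D.
Proof. exact: coprime_dvdr DM (unit_Zp_coprime u). Qed.

Definition red u : {unit 'I_D} := sval (unit_of_coprime (unit_Zp_coprime_dvd u)).

Lemma val_red u : val (red u) = inZp (val u).
Proof. by rewrite /red; case: unit_of_coprime. Qed.

Lemma redM : {in setT &, {morph red : u v / (u * v)%g}}.
Proof.
move=> u v _ _; apply/val_inj/val_inj; rewrite /= !val_red /=.
by rewrite modn_dvdm // modnMm.
Qed.

Canonical red_morphism := Morphism redM.

Lemma cycaut_red u k z : z ^+ D = 1 -> val (red u) = inZp k -> cycaut u z = z ^+ k.
Proof.
move=> zD Du; rewrite cycautE; last by have /dvdnP[j ->] := DM; rewrite mulnC exprM zD expr1n.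
by apply: (expr_eqmod zD); move: Du; rewrite val_red => /(congr1 val).
Qed.

(** Such an [f] multiplies the whole sum by [f x0 / x0]; as the sum is nonzero and fixed, this
    factor is 1. *)
Lemma near_ratio (f : {rmorphism algC -> algC}) s x0 : x0 != 0 ->
  {in s, forall x, f (x / x0) = x / x0} -> \sum_(x <- s) f x = \sum_(x <- s) x ->
  \sum_(x <- s) x != 0 -> f x0 = x0.
Proof.
move=> x00 fs fS S0; have S : \sum_(x <- s) f x = (\sum_(x <- s) x) / x0 * f x0.
  rewrite mulr_suml mulr_suml !big_seq; apply: eq_bigr => x xs.
  by rewrite -[in RHS]fs // fmorph_div divfK // fmorph_eq0.
apply: (mulfI (_ : (\sum_(x <- s) x) / x0 != 0)); first by rewrite mulf_neq0 // invr_eq0.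
by rewrite -S fS divfK.
Qed.

(** An element of [H] that is 1 modulo D fixes all ratios of terms, and therefore, by [near_ratio],
    all terms. *)
Lemma index_near_le H s : (forall x, x \in s -> x ^+ M = 1) -> near D s ->
  \sum_(x <- s) x != 0 ->
  {in H, forall u, \sum_(x <- s) cycaut u x = \sum_(x <- s) x} ->
  (#|H : H :&: fixes s|%g <= #|red @* H|%g)%N.
Proof.
move=> sM sD S0 Hs; have [K DK] := fixes_group sM.
have sN0 x : x \in s -> x != 0.
  by move=> /sM; apply: expr_eq1_neq0.
rewrite -DK indexgI cardE; apply: (index_le_size (f := red)) => [u uH|u v uH vH uv].
  by rewrite mem_enum mem_morphim ?inE.
have w1 : val (red (u * v^-1)%g) = inZp 1.
  by rewrite redM ?inE // uv -redM ?inE // mulgV val_red.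
have wH : (u * v^-1)%g \in H by rewrite groupM ?groupV.
set w := (u * v^-1)%g in w1 wH *; rewrite DK; apply/fixesP => x xs.
apply: (near_ratio (s := s)) => [|y ys||//]; [exact: sN0 | | exact: Hs].
by rewrite (cycaut_red _ w1) ?expr1 ?sD.
Qed.

End Reduction.

End Stabilizers.

(** * Terms that differ by 30th roots of unity *)

Lemma near_join k s t e : e != 0 -> near k s -> near k t -> e \in s -> e \in t ->
  near k (s ++ t).
Proof.
move=> e0 sk tk es et; apply: (near_common e0) => x.
by rewrite mem_cat => /orP[xs|xt]; [apply: sk | apply: tk].
Qed.

Definition class30 (s : seq algC) (y : algC) := count (fun x => (x / y) ^+ 30 == 1) s.

Lemma class30_near r y : near 30 r -> y \in r -> class30 r y = size r.
Proof.
by move=> rn yr; apply/eqP; rewrite -all_count; apply/allP => x xr; apply/eqP/rn.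
Qed.

(** Raising to the power 30 kills the sixth root of unity [z] and is injective on seventh roots of
    unity, so the four terms have distinct 30th powers. *)
Lemma heptagonal_class30 s y : heptagonal s -> y \in s -> (class30 s y <= 1)%N.
Proof.
move=> [x0 [z [w [a [b [c [x0U z6 w7 /andP[uabc abc7] ps]]]]]]] ys.
have x00 := root_of_unity_neq0 x0U.
pose g x := (x / x0) ^+ 30.
have u : uniq (map g s).
  rewrite (perm_uniq (perm_map g ps)) /= /g.
  have gw i : (x0 * w ^+ i / x0) ^+ 30 = w ^+ (30 * i).
    by rewrite mulrAC divff // mul1r exprAC exprM.
  have gz : (x0 * z / x0) ^+ 30 = w ^+ (30 * 0).
    by rewrite mulrAC divff // mul1r (exprM _ 6 5) (prim_expr_order z6) expr1n.
  rewrite gz !gw; move: uabc; rewrite -(map_inj_in_uniq (f := fun i => w ^+ (30 * i))) //.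
  have lt7 i : i \in [:: 0; a; b; c]%N -> (i < 7)%N.
    by rewrite inE => /orP[/eqP-> // | /(allP abc7)].
  move=> i j /lt7 i7 /lt7 j7 /eqP; rewrite (eq_prim_root_expr w7) => /eqP.
  by move: i j i7 j7 => [|[|[|[|[|[|[|i]]]]]]] [|[|[|[|[|[|[|j]]]]]]].
have y0 : y != 0.
  move: ys; rewrite (perm_mem ps) !inE.
  have w0 : w != 0 by apply: expr_eq1_neq0 (prim_expr_order w7).
  have z0 : z != 0 by apply: expr_eq1_neq0 (prim_expr_order z6).
  by case/or4P=> /eqP->; rewrite mulf_neq0 ?expf_neq0.
rewrite /class30 (@eq_count _ _ (preim g (pred1 (g y)))) => [|x /=].
  by rewrite -count_map count_uniq_mem // leq_b1.
have -> : x / y = (x / x0) / (y / x0) by rewrite invf_div mulrA divfK.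
have gy0 : g y != 0 by rewrite expf_neq0 // mulf_neq0 // invr_eq0.
by rewrite exprMn exprVn (can2_eq (divfK gy0) (mulfK gy0)) mul1r.
Qed.

Lemma heptagonal_not_near30 s : heptagonal s -> ~ near 30 s.
Proof.
move=> hs s30; have s4 : size s = 4%N.
  by case: hs => x0 [z [w [a [b [c [_ _ _ _ /perm_size]]]]]].
case Ds: s s4 => [|x r] // s4; have xs : x \in s by rewrite Ds mem_head.
by have := heptagonal_class30 hs xs; rewrite class30_near // Ds s4.
Qed.

(** Applied to [s] and its image under an automorphism u, this makes [u x0 / x0] a 30th root of
    unity. A term common to both lists is enough, and the comparison of representations supplies one
    unless it gives the conclusion directly. *)
Lemma near30_joint s t : minrep s -> minrep t -> near 30 s -> near 30 t ->
  \sum_(x <- s) x = \sum_(x <- t) x -> (size s == 3) || (size s == 4) -> near 30 (s ++ t).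
Proof.
move=> s_min t_min s30 t30 st sz.
have perm_case : perm_eq s t -> near 30 (s ++ t).
  move=> pst; case Ds: s sz => [|e r] // _; rewrite -Ds.
  have es : e \in s by rewrite Ds mem_head.
  apply: (near_join _ s30 t30 es); last by rewrite -(perm_mem pst).
  exact/root_of_unity_neq0/s_min.1.
case/orP: sz => /eqP sz.
  have [||//] := rep_unique_le3 s_min t_min _ st; first by rewrite sz.
  exact: perm_case.
have [||[hs _]|[e [r [r' [ps pt _ _]]]]] := rep_unique_4 s_min t_min sz st => //.
  by case: (heptagonal_not_near30 hs s30).
have es : e \in s by rewrite (perm_mem ps) mem_head.
apply: (near_join _ s30 t30 es); last by rewrite (perm_mem pt) mem_head.
exact/root_of_unity_neq0/s_min.1.
Qed.

Lemma minrep_subseq s t : subseq s t -> minrep t -> minrep s.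
Proof.
move=> /perm_to_subseq[r pt] t_min; apply: (@minrep_catl _ r).
exact: minrep_perm t_min.
Qed.

Lemma pairwise_subseq (T : eqType) (R : rel T) s :
  (forall x y, subseq [:: x; y] s -> R x y) -> pairwise R s.
Proof.
elim: s => //= a s IH H; apply/andP; split.
  by apply/allP => y ys; apply: H; rewrite eqxx sub1seq.
apply: IH => x y xy; apply: H; case: ifP => // _.
exact: subseq_trans (subseq_cons [:: y] x) xy.
Qed.

Section Irreducible.

Variables (z x0 : algC).
Hypotheses (z30 : 30.-primitive_root z) (x0U : root_of_unity x0).

Let zU i : root_of_unity (x0 * z ^+ i).
Proof.
apply: root_of_unityM => //; apply/root_of_unityP; exists 30%N => //.
by rewrite exprAC (prim_expr_order z30) expr1n.
Qed.

Lemma expr15 : z ^+ 15 = -1.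
Proof. exact/prim_root2/(dvdn_prim_root z30 (isT : 2 %| 30)%N). Qed.

Lemma sum_zero k p : (1 < p)%N -> (k * p)%N = 30%N -> \sum_(t < p) z ^+ (k * t) = 0.
Proof.
move=> p1 kp; under eq_bigr do rewrite exprM.
rewrite sum_unity_powers -?exprM ?kp ?(prim_expr_order z30) // ifN //.
rewrite -[1](expr0 z) (eq_prim_root_expr z30) mod0n -/(_ %| _)%N -kp.
by rewrite -{2}[k]muln1 dvdn_pmul2l ?dvdn1; case: k kp p1 => // ; lia.
Qed.

(** Opposite terms cancel, and two terms that differ by a nontrivial cube root of unity merge into
    the negative of the third vertex of their triangle. *)
Lemma minrep_pair i j : minrep [seq x0 * z ^+ k | k <- [:: i; j]] ->
  all (fun d => (i + d) %% 30 != j)%N [:: 10; 15; 20]%N.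
Proof.
move=> [_ smin]; apply/allP => d d3; apply/eqP => Dj.
have {Dj} e : \sum_(x <- [seq x0 * z ^+ k | k <- [:: i; j]]) x = x0 * z ^+ i * (1 + z ^+ d).
  by rewrite !big_cons big_nil addr0 -Dj (prim_expr_mod z30) exprD; ring.
have w3 : 1 + z ^+ 10 + z ^+ 20 = 0.
  rewrite -[RHS](@sum_zero 10 3) // !big_ord_recr big_ord0 /=.
  by rewrite muln0 muln1 expr0 add0r.
suff [t [tU ts tS]] : exists t : seq algC, [/\ forall x, x \in t -> root_of_unity x,
    (size t < 2)%N & \sum_(x <- t) x = x0 * z ^+ i * (1 + z ^+ d)].
  by have := smin t tU; rewrite e => /(_ tS) /=; rewrite leqNgt ts.
move: d3; rewrite !inE => /or3P[] /eqP->.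
- exists [:: - (x0 * z ^+ (i + 20))]; split=> // [x|].
    by rewrite inE => /eqP->; apply/root_of_unityN/zU.
  have -> : 1 + z ^+ 10 = - z ^+ 20 by apply/eqP; rewrite -addr_eq0 w3.
  by rewrite big_seq1 exprD; ring.
- by exists [::]; split=> //; rewrite expr15 subrr mulr0 big_nil.
- exists [:: - (x0 * z ^+ (i + 10))]; split=> // [x|].
    by rewrite inE => /eqP->; apply/root_of_unityN/zU.
  have -> : 1 + z ^+ 20 = - z ^+ 10 by apply/eqP; rewrite -addr_eq0 addrAC w3.
  by rewrite big_seq1 exprD; ring.
Qed.

(** The vertices of a pentagon sum to 0, so three or more of them can be replaced by the negatives
    of the at most two others. *)
Lemma minrep_pentagon y t : minrep [seq x0 * z ^+ k | k <- t] -> (y < 6)%N ->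
  uniq t -> all (fun i => (i < 30) && (i %% 6 == y))%N t -> (size t < 3)%N.
Proof.
move=> [_ tmin] y6 ut tP; pose C := [seq (y + 6 * k)%N | k <- iota 0 5].
have uC : uniq C by rewrite map_inj_uniq ?iota_uniq // => a b; lia.
have tC : {subset t <= C}.
  move=> i /(allP tP) /andP[i30 /eqP iy]; apply/mapP; exists (i %/ 6)%N.
    by rewrite mem_iota /= add0n ltn_divLR.
  by rewrite {1}(divn_eq i 6) iy addnC mulnC.
pose R := filter (predC (mem t)) C.
have pC : perm_eq C (t ++ R).
  rewrite -(perm_filterC (mem t) C) perm_cat2r.
  apply: uniq_perm; rewrite ?filter_uniq // => i; rewrite mem_filter inE.
  by apply: andb_idr => /tC.
have sumC : \sum_(k <- C) x0 * z ^+ k = 0.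
  rewrite big_map -mulr_sumr -[in LHS]/(index_iota 0 5) big_mkord.
  under eq_bigr do rewrite exprD.
  by rewrite -mulr_sumr (@sum_zero 6 5) // !mulr0.
have := tmin [seq - (x0 * z ^+ k) | k <- R].
rewrite !size_map !big_map => H.
have szC := perm_size pC; rewrite size_cat /= in szC.
rewrite ltnNge; apply/negP => t3; have : (size t <= size R)%N; last first.
  by move: szC t3; move: (size t) (size R) => a b; lia.
apply: H => [x /mapP[k _ ->]|]; first exact/root_of_unityN/zU.
rewrite sumrN; apply/eqP; rewrite eq_sym -addr_eq0 -[X in _ == X]sumC (perm_big _ pC).
by rewrite big_cat.
Qed.

Lemma minrep_irreducible30 (e : seq nat) : minrep [seq x0 * z ^+ k | k <- e] ->
  all (gtn 30) e -> irreducible30 e.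
Proof.
move=> e_min e30; apply/andP; split.
  apply: pairwise_subseq => i j ij; apply: minrep_pair.
  exact: minrep_subseq (map_subseq _ ij) e_min.
apply/allP => y; rewrite mem_iota /= add0n => y6.
apply: (@minrep_pentagon y) => //; last 1 first.
- apply/allP => i; rewrite mem_undup mem_filter => /andP[-> /(allP e30) i30].
  by rewrite andbT.
- apply: minrep_subseq e_min; apply: map_subseq.
  exact: subseq_trans (undup_subseq _) (filter_subseq _ _).
- exact: undup_uniq.
Qed.

End Irreducible.

Lemma card_unit_Zp n : #|{: {unit 'I_n.+2}}| = totient n.+2.
Proof. by rewrite -(@card_units_Zp n.+2) // cardsT. Qed.

(* The exponents are kept in increasing order to match sorted_pairs and sorted_triples. *)
Lemma near_exponents n (z x0 : algC) s : n.-primitive_root z -> x0 != 0 ->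
  near n (x0 :: s) -> exists r : seq nat,
    [/\ sorted leq r, all (gtn n) r, size r = size s &
        perm_eq (x0 :: s) [seq x0 * z ^+ i | i <- 0%N :: r]].
Proof.
move=> zn x00 sn.
have [r [rn szr Dr]] : exists r : seq nat,
    [/\ all (gtn n) r, size r = size s & s = [seq x0 * z ^+ i | i <- r]].
  elim: s sn => [|x s IH] sn; first by exists [::].
  have [|r [rn szr ->]] := IH.
    by apply: near_sub sn => y; rewrite !inE => /orP[->|->]; rewrite ?orbT.
  have /(prim_rootP zn)[i Di] : (x / x0) ^+ n = 1.
    by apply: sn; rewrite !inE eqxx ?orbT.
  exists (val i :: r); split=> /=; first by rewrite ltn_ord.
    by rewrite size_map.
  by rewrite -Di mulrC divfK.
exists (sort leq r); split; rewrite ?size_sort //.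
- exact/sort_sorted/leq_total.
- by rewrite all_sort.
rewrite /= expr0 mulr1 perm_cons {1}Dr; apply: perm_map.
by rewrite perm_sym perm_sort.
Qed.

(* When the two sides of u (x0 * S) = x0 * S are compared, the unknown factor
   u x0 / x0 is a D-th root of unity and disappears in D-th powers. *)
Lemma twisted_power_sum D (f : {rmorphism algC -> algC}) k (s : seq algC) (z x0 : algC)
    (e : seq nat) :
  x0 != 0 -> f z = z ^+ k -> (f x0 / x0) ^+ D = 1 ->
  perm_eq s [seq x0 * z ^+ i | i <- e] ->
  \sum_(x <- s) f x = \sum_(x <- s) x ->
  (\sum_(i <- e) z ^+ (k * i)) ^+ D = (\sum_(i <- e) z ^+ i) ^+ D.
Proof.
move=> x00 fz fx0 ps; rewrite (perm_big _ ps) [RHS](perm_big _ ps) !big_map => S.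
have fx00 : f x0 != 0 by rewrite fmorph_eq0.
have eS : f x0 * \sum_(i <- e) z ^+ (k * i) = x0 * \sum_(i <- e) z ^+ i.
  rewrite !mulr_sumr -S; apply: eq_bigr => i _.
  by rewrite rmorphM rmorphXn fz -exprM.
by rewrite -[LHS]mul1r -fx0 -exprMn mulrAC eS mulrAC divff // mul1r.
Qed.

Section Index.

Variable m : nat.
Local Notation M := m.+2.
Local Notation G := {unit 'I_M}.
Implicit Types (H K : {group G}) (u v : G).

Lemma minrep_aut (f : {rmorphism algC -> algC}) s : minrep s ->
  \sum_(x <- s) f x = \sum_(x <- s) x -> minrep (map f s).
Proof.
move=> s_min fs; apply: (minrep_eq s_min); rewrite ?size_map ?big_map //.
move=> _ /mapP[x /s_min.1 /root_of_unityP[n n0 xn] ->].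
by apply/root_of_unityP; exists n; rewrite // -rmorphXn xn rmorph1.
Qed.

Lemma near_aut (f : {rmorphism algC -> algC}) k s : near k s -> near k (map f s).
Proof.
move=> sk _ _ /mapP[x xs ->] /mapP[y ys ->].
by rewrite -fmorph_div -rmorphXn sk ?rmorph1.
Qed.

Lemma minrep_sum_neq0 s : minrep s -> (0 < size s)%N -> \sum_(x <- s) x != 0.
Proof.
move=> [_ smin] s0; apply: contraTneq s0 => S0; rewrite -leqNgt.
by apply: (smin [::]); rewrite ?big_nil.
Qed.

Lemma index_near30_le H (s : seq algC) : (30 %| M)%N -> (forall x, x \in s -> x ^+ M = 1) ->
  minrep s -> near 30 s -> (size s == 3) || (size s == 4) ->
  {in H, forall u, \sum_(x <- s) cycaut u x = \sum_(x <- s) x} ->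
  (#|H : H :&: fixes m s|%g <= 4)%N.
Proof.
move=> M30 sM s_min s30 sz Hs.
have S0 : \sum_(x <- s) x != 0 by apply: minrep_sum_neq0 => //; case: (s) sz.
have M10 : (10 %| M)%N by apply: dvdn_trans M30.
have M6 : (6 %| M)%N by apply: dvdn_trans M30.
have [z z30] := C_prim_root_exists (isT : 0 < 30)%N.
case Ds: s (sz) => [|x0 s'] // sz'; rewrite -Ds.
have x0s : x0 \in s by rewrite Ds mem_head.
have x0U := s_min.1 _ x0s; have x00 := root_of_unity_neq0 x0U.
have [|r [r_sorted r30 szr]] := near_exponents z30 x00 (_ : near 30 (x0 :: s')).
  by rewrite -Ds.
rewrite -Ds; set e := 0%N :: r => ps.
have e30 : all (gtn 30) e by [].
have multE k l : (k * l)%N = 30%N -> multiples_of k e -> near l s.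
  move=> kl /allP ek; apply: (near_common x00) => x; rewrite (perm_mem ps).
  move=> /mapP[i /ek /dvdnP[j ->] ->].
  by rewrite mulrAC divff // mul1r -exprM -mulnA kl mulnC exprM (prim_expr_order z30) expr1n.
(* Here the terms are 10th roots of unity up to rotation, and there are four units modulo 10. The
   next case leaves 6th roots of unity and two units. *)
have [m3 | m3] := boolP (multiples_of 3 e).
  have s10 : near (8.+2) s by apply: multE m3.
  apply: leq_trans (index_near_le M10 sM s10 S0 Hs) _.
  by apply: leq_trans (max_card _) _; rewrite card_unit_Zp.
have [m5 | m5] := boolP (multiples_of 5 e).
  have s6 : near (4.+2) s by apply: multE m5.
  apply: leq_trans (index_near_le M6 sM s6 S0 Hs) _.
  by apply: leq_trans (max_card _) _; rewrite card_unit_Zp.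
have irr : irreducible30 e.
  by apply: (minrep_irreducible30 z30 x0U _ e30); apply: minrep_perm ps s_min.
apply: leq_trans (index_near_le M30 sM (s30 : near (28.+2) s) S0 Hs) _.
have [v Dv] : {v : {unit 'I_30} | val v = inZp 7} by apply: unit_of_coprime.
have nv : v \notin (red_morphism M30 @* H)%g.
  apply/negP => /morphimP[u _ uH /= Du].
  have u7 : val (red M30 u) = inZp 7 by rewrite -Du.
  have szr' : (size r == 2) || (size r == 3) by rewrite szr; move: sz'.
  apply: (check30_sum z30 r_sorted r30 szr' irr m3 m5); rewrite -/e.
  have zu : cycaut u z = z ^+ 7.
    by apply: (cycaut_red (d := 28) _ u7); apply: prim_expr_order.
  apply: (twisted_power_sum x00 zu _ ps (Hs u uH)).
  have st : near 30 (s ++ map (cycaut u) s).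
    by apply: near30_joint; rewrite ?big_map ?Hs //; [exact/minrep_aut/Hs | exact: near_aut].
  by apply: st; rewrite mem_cat ?x0s // map_f ?orbT.
set A := (_ @* H)%g in nv *; have c8 : #|[set: {unit 'I_30}]| = 8%N.
  by rewrite cardsT card_unit_Zp.
have : (#|A| %| #|[set: {unit 'I_30}]|)%N by apply/cardSg/subsetT.
have : (#|A| < #|[set: {unit 'I_30}]|)%N.
  by apply: proper_card; rewrite properE subsetT; apply/subsetPn; exists v.
by rewrite c8; case: #|A| => [|[|[|[|[|[|[|[|k]]]]]]]].
Qed.

End Index.

(** * The exceptional numbers *)

Lemma sum_unity7 (w : algC) : 7.-primitive_root w ->
  1 + (w + w ^+ 2 + w ^+ 4) + (w ^+ 6 + w ^+ 5 + w ^+ 3) = 0.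
Proof.
move=> w7; have := sum_unity_powers (prim_expr_order w7); rewrite ifN; last first.
  by rewrite -[w]expr1 -[1](expr0 w) (eq_prim_root_expr w7).
by move=> <-; rewrite !big_ord_recr big_ord0 /= expr0 expr1; ring.
Qed.

Lemma sixth_root_sq (z : algC) : 6.-primitive_root z -> z ^+ 2 = z - 1.
Proof.
move=> z6; have z3 := sixth_root_cube z6.
have z1 : z + 1 != 0.
  apply/eqP => /eqP; rewrite addr_eq0 -z3 -{1}[z]expr1 (eq_prim_root_expr z6) //.
apply/eqP; rewrite -subr_eq0 -(mulrI_eq0 _ (mulfI z1)); apply/eqP.
by transitivity (z ^+ 3 + 1); [ring | rewrite z3 addNr].
Qed.

Definition heptasum (z w : algC) := z + w + w ^+ 2 + w ^+ 4.

Lemma heptasum_sq (z w : algC) : 6.-primitive_root z -> 7.-primitive_root w ->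
  heptasum z (w ^+ 2) = heptasum z w.
Proof.
move=> z6 w7; have w8 : w ^+ 2 ^+ 4 = w by rewrite -exprM -(prim_expr_mod w7).
by rewrite /heptasum w8 -exprM; ring.
Qed.

(** This is complex conjugation: [z] and its conjugate add up to 1, the two periods of seventh roots
    of unity to -1, so the sum is purely imaginary. *)
Lemma heptasum_conj (z w : algC) : 6.-primitive_root z -> 7.-primitive_root w ->
  heptasum (z ^+ 5) (w ^+ 6) = - heptasum z w.
Proof.
move=> z6 w7; have z2 := sixth_root_sq z6.
have z5 : z ^+ 5 = 1 - z.
  have -> : z ^+ 5 = z ^+ 2 * (z ^+ 2 * z) by ring.
  rewrite z2; have -> : (z - 1) * ((z - 1) * z) = (z - 2%:R) * z ^+ 2 + z by ring.
  rewrite z2; have -> : (z - 2%:R) * (z - 1) + z = z ^+ 2 - 2%:R * z + 2%:R by ring.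
  by rewrite z2; ring.
have w12 : w ^+ 6 ^+ 2 = w ^+ 5 by rewrite -exprM -(prim_expr_mod w7).
have w24 : w ^+ 6 ^+ 4 = w ^+ 3 by rewrite -exprM -(prim_expr_mod w7).
have := sum_unity7 w7; rewrite /heptasum z5 w12 w24 => S.
by apply/eqP; rewrite -subr_eq0 -S; apply/eqP; ring.
Qed.

Lemma heptagonal_exponents (z w : algC) : 6.-primitive_root z -> 7.-primitive_root w ->
  [/\ 42.-primitive_root (z * w), z = (z * w) ^+ 7 & w = (z * w) ^+ 36].
Proof.
move=> z6 w7; have zE : z = (z * w) ^+ 7.
  by rewrite exprMn (prim_expr_order w7) mulr1 -(prim_expr_mod z6).
have wE : w = (z * w) ^+ 36.
  rewrite exprMn (exprM z 6 6) (prim_expr_order z6) expr1n mul1r.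
  by rewrite -[RHS](prim_expr_mod w7).
split=> //; have zw42 : (z * w) ^+ 42 = 1.
  by rewrite (exprM _ 7 6) -zE prim_expr_order.
have [k prk k42] := prim_order_exists (isT : 0 < 42)%N zw42.
suff -> : 42%N = k by [].
apply/eqP; rewrite eqn_dvd k42 andbT (@Gauss_dvd 6 7) //.
rewrite (prim_order_dvd z6) (prim_order_dvd w7).
have -> : z ^+ k = 1 by rewrite zE exprAC (prim_expr_order prk) expr1n.
have -> : w ^+ k = 1 by rewrite wE exprAC (prim_expr_order prk) expr1n.
by rewrite eqxx.
Qed.

Lemma heptagonal_near42 s : heptagonal s -> near 42 s.
Proof.
move=> [x0 [z [w [a [b [c [x0U z6 w7 _ ps]]]]]]].
apply: (near_common (root_of_unity_neq0 x0U)) => x; rewrite (perm_mem ps) !inE.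
have x00 := root_of_unity_neq0 x0U.
have w42 i : (w ^+ i) ^+ 42 = 1.
  by rewrite exprAC (exprM _ 7 6) (prim_expr_order w7) !expr1n.
case/or4P=> /eqP->; rewrite mulrAC divff // mul1r ?w42 //.
by rewrite (exprM _ 6 7) (prim_expr_order z6) expr1n.
Qed.

Lemma heptagonal_joint s t : minrep s -> minrep t -> heptagonal s ->
  near 42 t -> \sum_(x <- s) x = \sum_(x <- t) x -> near 42 (s ++ t).
Proof.
move=> s_min t_min hs t42 st; have s42 := heptagonal_near42 hs.
have s4 : size s = 4%N by case: hs => x0 [z [w [a [b [c [_ _ _ _ /perm_size]]]]]].
have join e : e \in s -> e \in t -> near 42 (s ++ t).
  by move=> es et; apply: (near_join _ s42 t42 es et); apply/root_of_unity_neq0/s_min.1.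
have [pst|n30|[_ //]|[e [r [r' [ps pt _ _]]]]] := rep_unique_4 s_min t_min s4 st.
- case Ds: s s4 => [|e s'] // _; rewrite -Ds; apply: (join e); first by rewrite Ds mem_head.
  by rewrite -(perm_mem pst) Ds mem_head.
- case: (heptagonal_not_near30 hs); apply: near_sub n30 => x xs.
  by rewrite mem_cat xs.
- by apply: (join e); rewrite ?(perm_mem ps) ?(perm_mem pt) mem_head.
Qed.

Section Index.

Variable m : nat.
Local Notation M := m.+2.
Local Notation G := {unit 'I_M}.
Implicit Types (H K : {group G}) (u v : G).

Definition extremal (s : seq algC) (x0 z w : algC) :=
  [/\ root_of_unity x0, 6.-primitive_root z, 7.-primitive_root w &
      perm_eq s [:: x0 * z; x0 * w; x0 * w ^+ 2; x0 * w ^+ 4]].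

(** The two automorphisms generate, on 42nd roots of unity, all six admissible classes; their action
    on [x0] is what determines the order of the rotation. *)
Definition extremal_symmetry H (s : seq algC) := exists x0 z w,
  [/\ extremal s x0 z w,
      exists2 u, u \in H & [/\ cycaut u z = z, cycaut u w = w ^+ 2 & cycaut u x0 = x0] &
      exists2 u, u \in H & [/\ cycaut u z = z ^+ 5, cycaut u w = w ^+ 6 &
                               cycaut u x0 = - x0]].

(** The non-squares modulo 7 are 3 times the squares, so in that case [w ^+ 3] takes the place of
    [w]. *)
Lemma residues_extremal s x0 z w a b c : root_of_unity x0 ->
  6.-primitive_root z -> 7.-primitive_root w -> residues [:: a; b; c] ->
  perm_eq s [:: x0 * z; x0 * w ^+ a; x0 * w ^+ b; x0 * w ^+ c] ->
  exists w', extremal s x0 z w'.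
Proof.
move=> x0U z6 w7 res ps.
have pmap (l : seq nat) : perm_eq [:: a; b; c] l ->
    perm_eq s (x0 * z :: [seq x0 * w ^+ i | i <- l]).
  move=> pl; apply: perm_trans ps _; rewrite perm_cons.
  exact: (perm_map (fun i => x0 * w ^+ i) pl).
case/orP: res => /pmap /=; first by exists w; split.
have w6 : w ^+ 3 ^+ 2 = w ^+ 6 by rewrite -exprM.
have w5 : w ^+ 3 ^+ 4 = w ^+ 5 by rewrite -exprM -(prim_expr_mod w7).
move=> {}ps; exists (w ^+ 3); split=> //; first by rewrite prim_root_exp_coprime.
rewrite w6 w5; apply: perm_trans ps _; rewrite !perm_cons.
by rewrite (perm_catC [:: _] [:: _]).
Qed.

Lemma index_heptagonal H (s : seq algC) : (42 %| M)%N -> (forall x, x \in s -> x ^+ M = 1) ->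
  minrep s -> heptagonal s ->
  {in H, forall u, \sum_(x <- s) cycaut u x = \sum_(x <- s) x} ->
  let i := #|H : H :&: fixes m s|%g in
  (i <= 6)%N /\ (i = 6%N -> extremal_symmetry H s).
Proof.
move=> M42 sM s_min hs Hs i.
have s42 := heptagonal_near42 hs.
case: (hs) => x0 [z [w [a [b [c [x0U z6 w7 /andP[uabc abc7] ps]]]]]].
have x00 := root_of_unity_neq0 x0U.
have s4 : size s = 4%N by apply: perm_size ps.
have S0 : \sum_(x <- s) x != 0 by apply: minrep_sum_neq0; rewrite ?s4.
have [y42 zE wE] := heptagonal_exponents z6 w7; set y := z * w in y42 zE wE.
have abc6 : all (fun i => 0 < i < 7)%N [:: a; b; c].
  move: uabc abc7; rewrite /= !inE !negb_or => /andP[/and3P[a0 b0 c0] _].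
  by rewrite !lt0n ![_ == 0%N]eq_sym a0 b0 c0.
have uabc' : uniq [:: a; b; c] by case/andP: uabc.
have pe : perm_eq s [seq x0 * y ^+ k | k <- heptexp a b c].
  apply: perm_trans ps _; rewrite /heptexp -map_comp.
  have modE k : x0 * y ^+ (k %% 42) = x0 * y ^+ k by rewrite (prim_expr_mod y42).
  have wyE k : x0 * w ^+ k = x0 * y ^+ (36 * k) by rewrite exprM -wE.
  by rewrite /= !modE -!wyE -zE.
have yM u k : val (red M42 u) = inZp k -> cycaut u y = y ^+ k.
  by move=> Du; apply: (cycaut_red (d := 40) _ Du); apply: prim_expr_order.
have Hx0 u : u \in H -> (cycaut u x0 / x0) ^+ 42 = 1.
  move=> uH; have st : near 42 (s ++ map (cycaut u) s).
    apply: heptagonal_joint => //; rewrite ?big_map ?Hs //; [exact/minrep_aut/Hs | exact: near_aut].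
  have xs : x0 * z \in s by rewrite (perm_mem ps) mem_head.
  have := st (cycaut u (x0 * z)) (x0 * z).
  rewrite !mem_cat xs map_f // orbT => /(_ isT isT).
  rewrite rmorphM -mulf_div exprMn [X in _ * X]exprMn exprVn -rmorphXn.
  have -> : z ^+ 42 = 1 by rewrite (exprM _ 6 7) (prim_expr_order z6) expr1n.
  by rewrite rmorph1 invr1 !mulr1.
have check u k : u \in H -> val (red M42 u) = inZp k ->
    k \notin [:: 11; 13; 19; 23; 29; 31]%N /\ (k = 37%N -> residues [:: a; b; c]).
  move=> uH Du; apply: (check42_sum y42 abc6 uabc').
  exact: (twisted_power_sum x00 (yM u k Du) (Hx0 u uH) pe (Hs u uH)).
pose A := (red_morphism M42 @* H)%G.
have iA : (i <= #|A|)%N by apply: (index_near_le M42 sM (s42 : near (40.+2) s)).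
pose vals := [seq nat_of_ord (val v : 'I_42) | v : {unit 'I_42} in A].
have szA : size vals = #|A| by rewrite size_image.
have uA : uniq vals.
  by rewrite map_inj_uniq ?enum_uniq // => v1 v2 /val_inj /val_inj.
pose L := [:: 1; 5; 17; 25; 37; 41]%N.
have inA k : k \in vals -> exists2 u, u \in H & val (red M42 u) = inZp k.
  case/imageP => v /morphimP[u _ uH ->] ->; exists u => //.
  by apply/val_inj; rewrite /= modn_small //; apply: ltn_ord.
have AL : {subset vals <= L}.
  move=> k kA; have [u uH Du] := inA k kA.
  have [nk _] := check u k uH Du.
  have k42 : (k < 42)%N by case/imageP: kA => v _ ->; apply: ltn_ord.
  have ck : coprime k 42.
    have := unit_Zp_coprime (red M42 u); rewrite Du /= coprime_modl //.
  by move: nk; move: k k42 ck {kA Du}; do 42?[case=> //].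
have A6 : (#|A| <= 6)%N by rewrite -szA; apply: (uniq_leq_size uA AL).
split=> [|i6]; first exact: leq_trans iA A6.
(* Index 6 forces the image of [H] modulo 42 to be all of [L], so it contains 37 and 41. *)
have LA : {subset L <= vals}.
  have szL : (size L <= size vals)%N by rewrite szA -[size L]i6.
  by have [_ vL] := uniq_min_size uA AL szL; move=> k; rewrite vL.
have [s37 s37H D37] := inA 37%N (LA 37%N isT).
have [s41 s41H D41] := inA 41%N (LA 41%N isT).
have res : residues [:: a; b; c] by apply: (check _ _ s37H D37).2.
have [w' ext] := residues_extremal x0U z6 w7 res ps.
case: (ext) => _ _ w'7 pw.
have Sw (f : algC -> algC) :
    \sum_(x <- s) f x = f (x0 * z) + f (x0 * w') + f (x0 * w' ^+ 2) + f (x0 * w' ^+ 4).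
  by rewrite (perm_big _ pw) /= !big_cons big_nil addr0 !addrA.
have hS : \sum_(x <- s) x = x0 * heptasum z w'.
  by rewrite (Sw id) /heptasum; ring.
have hS0 : heptasum z w' != 0.
  by move: S0; rewrite hS mulf_eq0 negb_or => /andP[].
have hSf (f : {rmorphism algC -> algC}) :
    \sum_(x <- s) f x = f x0 * heptasum (f z) (f w').
  by rewrite Sw !(rmorphM f x0) !rmorphXn /heptasum; ring.
have zM u k : val (red M42 u) = inZp k -> cycaut u z = z ^+ k.
  move=> Du; apply: (cycaut_red (d := 40) _ Du).
  by rewrite (exprM z 6 7) (prim_expr_order z6) expr1n.
have wM u k : val (red M42 u) = inZp k -> cycaut u w' = w' ^+ k.
  move=> Du; apply: (cycaut_red (d := 40) _ Du).
  by rewrite (exprM w' 7 6) (prim_expr_order w'7) expr1n.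
have z37 : cycaut s37 z = z by rewrite (zM _ _ D37) -(prim_expr_mod z6).
have w37 : cycaut s37 w' = w' ^+ 2 by rewrite (wM _ _ D37) -(prim_expr_mod w'7).
have z41 : cycaut s41 z = z ^+ 5 by rewrite (zM _ _ D41) -(prim_expr_mod z6).
have w41 : cycaut s41 w' = w' ^+ 6 by rewrite (wM _ _ D41) -(prim_expr_mod w'7).
(* The class of 37 leaves [heptasum z w'] unchanged and the class of 41 negates it; as the product
   with [x0] is fixed, the action on [x0] follows by cancelling the nonzero sum. *)
exists x0, z, w'; split=> //.
  exists s37 => //; split=> //; apply: (mulIf hS0).
  by rewrite -hS -(Hs _ s37H) hSf z37 w37 heptasum_sq.
exists s41 => //; split=> //; apply: (mulIf hS0).
by rewrite mulNr -hS -(Hs _ s41H) hSf z41 w41 heptasum_conj // mulrN opprK.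
Qed.

End Index.

Lemma class30_aut (f : {rmorphism algC -> algC}) s y : class30 (map f s) (f y) = class30 s y.
Proof.
rewrite /class30 count_map; apply: eq_count => x /=.
by rewrite -fmorph_div -rmorphXn fmorph_eq1.
Qed.

Lemma class30_perm s t y : perm_eq s t -> class30 s y = class30 t y.
Proof. by move=> /seq.permP; apply. Qed.

(** The class of [e] modulo 30th roots of unity has one element, that of the other terms three, and
    [f] preserves these sizes. Comparing [s] with its image, every possible case identifies the
    isolated terms [e] and [f e]. *)
Lemma isolated_fixed (f : {rmorphism algC -> algC}) s e r : minrep s -> size s = 4%N ->
  perm_eq s (e :: r) -> near 30 r -> ~ near 30 s ->
  \sum_(x <- s) f x = \sum_(x <- s) x -> f e = e.
Proof.
move=> s_min s4 ps r30 s30 fs.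
have r3 : size r = 3%N by have := perm_size ps; rewrite s4 => -[].
have sN0 x : x \in s -> x != 0 by move=> /s_min.1 /root_of_unity_neq0.
have es : e \in s by rewrite (perm_mem ps) mem_head.
have rs x : x \in r -> x \in s by rewrite (perm_mem ps) inE orbC => ->.
have er x : x \in r -> (x / e) ^+ 30 != 1.
  move=> xr; apply/eqP => xe; apply: s30; apply: (near_common (sN0 _ (rs x xr))) => y.
  rewrite (perm_mem ps) inE => /orP[/eqP-> | yr]; last exact: r30.
  by rewrite -[e / x]invf_div exprVn xe invr1.
have ee : (e / e) ^+ 30 = 1 by rewrite divff ?expr1n ?sN0.
have ce : class30 s e = 1%N.
  rewrite (class30_perm _ ps) /class30 /= ee eqxx; congr _.+1; apply/eqP.
  by rewrite -leqn0 leqNgt -has_count; apply/hasPn => x /er.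
have big_class x0 r0 s0 y : perm_eq s0 (x0 :: r0) -> size r0 = 3%N -> near 30 r0 -> y \in r0 ->
    (3 <= class30 s0 y)%N.
  by move=> p0 z0 n0 y0; rewrite (class30_perm _ p0) -z0 -(class30_near n0 y0) leq_addl.
pose t := map f s; have t_min : minrep t := minrep_aut s_min fs.
have fes : f e \in t by rewrite map_f.
have cfe : class30 t (f e) = 1%N by rewrite class30_aut.
have st : \sum_(x <- s) x = \sum_(x <- t) x by rewrite big_map fs.
have e_image : e \in t -> class30 t e = 1%N -> f e = e.
  case/mapP => x xs Dx cx; rewrite Dx class30_aut in cx.
  move: (xs); rewrite (perm_mem ps) inE => /orP[/eqP xe | xr].
    by rewrite -{1}xe -Dx.
  by have := big_class _ _ _ _ ps r3 r30 xr; rewrite cx.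
have [pst|st30|[hs _]|[e1 [r1 [r1' [ps1 pt1 r1_3 n1]]]]] := rep_unique_4 s_min t_min s4 st.
- by apply: e_image; rewrite -?(perm_mem pst) // -(class30_perm _ pst).
- by case: s30; apply: near_sub st30 => x xs; rewrite mem_cat xs.
- case: r r3 ps r30 rs {er e_image} => // x r r3 ps r30 rs.
  have := big_class _ _ _ x ps r3 r30 (mem_head _ _).
  by rewrite leqNgt ltnS (leq_trans (heptagonal_class30 hs _)) // rs ?mem_head.
have r1'_3 : size r1' = 3%N by have := perm_size pt1; rewrite size_map s4 => -[].
have n1s : near 30 r1 by apply: near_sub n1 => x xr; rewrite mem_cat xr.
have n1t : near 30 r1' by apply: near_sub n1 => x xr; rewrite mem_cat xr orbT.
have e1e : e1 = e.
  move: es; rewrite (perm_mem ps1) inE => /orP[/eqP // | er1].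
  by have := big_class _ _ _ _ ps1 r1_3 n1s er1; rewrite ce.
move: fes; rewrite (perm_mem pt1) inE e1e => /orP[/eqP // | fer].
by have := big_class _ _ _ _ pt1 r1'_3 n1t fer; rewrite cfe.
Qed.

Section Index.

Variable m : nat.
Local Notation M := m.+2.
Local Notation G := {unit 'I_M}.
Implicit Types (H K : {group G}) (u v : G).

Lemma fixes_perm s t : perm_eq s t -> fixes m s = fixes m t.
Proof. by move=> st; apply/setP=> u; rewrite !inE (perm_all _ st). Qed.

Lemma index_fixes_le H (s : seq algC) : (210 %| M)%N -> (forall x, x \in s -> x ^+ M = 1) ->
  minrep s -> size s = 4%N ->
  {in H, forall u, \sum_(x <- s) cycaut u x = \sum_(x <- s) x} ->
  let i := #|H : H :&: fixes m s|%g in (i <= 6)%N /\ (i = 6%N -> extremal_symmetry H s).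
Proof.
move=> M210 sM s_min s4 Hs i.
have M30 : (30 %| M)%N by apply: dvdn_trans M210.
have M42 : (42 %| M)%N by apply: dvdn_trans M210.
suff H4 : (i <= 4)%N \/ heptagonal s.
  case: H4 => [i4 | hs]; last exact: index_heptagonal.
  by split=> [|i6]; [apply: leq_trans i4 _ | rewrite i6 in i4].
have [/forall_inP Hp | /forall_inPn[u uH nu]] :=
    boolP [forall u in H, perm_eq (map (cycaut u) s) s].
  by left; have := index_permuted_le sM Hp; rewrite s4; apply.
have near_case : near 30 s -> (i <= 4)%N.
  by move=> s30; apply: index_near30_le; rewrite ?s4.
pose t := map (cycaut u) s; have t_min : minrep t by apply: minrep_aut (Hs u uH).
have st : \sum_(x <- s) x = \sum_(x <- t) x by rewrite big_map Hs.
have [pst|st30|[hs _]|[e [r [r' [ps _ r3 n30]]]]] := rep_unique_4 s_min t_min s4 st.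
- by rewrite perm_sym pst in nu.
- by left; apply: near_case; apply: near_sub st30 => x xs; rewrite mem_cat xs.
- by right.
have r30 : near 30 r by apply: near_sub n30 => x xr; rewrite mem_cat xr.
have [/allP s30 | s30] := boolP (all (fun x => all (fun y => (x / y) ^+ 30 == 1) s) s).
  by left; apply: near_case => x y /s30 /allP xs /xs /eqP.
have {}s30 : ~ near 30 s.
  by move=> n; case/negP: s30; apply/allP => x xs; apply/allP => y ys; apply/eqP/n.
have eH : {in H, forall v, cycaut v e = e}.
  by move=> v vH; apply: (isolated_fixed s_min s4 ps r30 s30 (Hs v vH)).
left; rewrite /i (fixes_perm ps) -[e :: r]/([:: e] ++ r) fixes_cat setIA.
rewrite (setIidPl _ : H :&: fixes m [:: e] = H); last first.
  by apply/subsetP => v vH; apply/fixesP => x; rewrite inE => /eqP->; apply: eH.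
have rs x : x \in r -> x \in s by rewrite (perm_mem ps) inE orbC => ->.
have r34 : (size r == 3) || (size r == 4) by rewrite r3.
have r_min : minrep r.
  apply: (@minrep_catl _ [:: e]); apply: minrep_perm s_min.
  by rewrite (permPl ps) -cat1s perm_catC.
apply: index_near30_le => // [x /rs/sM // | v vH].
have := Hs v vH; rewrite (perm_big _ ps) [RHS](perm_big _ ps) /= !big_cons eH //.
exact: addrI.
Qed.

End Index.

(** * Conductors *)

Lemma oppr1_neq1 : -1 != 1 :> algC.
Proof. by rewrite eqNr oner_eq0. Qed.

(** Since 7 is prime, only [y = 1] and [y = -1] must be excluded; the second is, because a principal
    seventh root is never negative. *)
Lemma zeta7_prim : 7.-primitive_root (zeta 7).
Proof.
set y : algC := 7.-root (-1); have y7 : y ^+ 7 = -1 by apply: rootCK.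
have Dz : zeta 7 = y ^+ 2 by [].
have z7 : zeta 7 ^+ 7 = 1 by rewrite Dz exprAC y7 sqrrN expr1n.
apply: primitive_root_cofactors => // p p_pr.
rewrite dvdn_prime2 // => /eqP->; rewrite divnn expr1 Dz sqrf_eq1 negb_or.
apply/andP; split.
  by apply: contra_eq_neq y7 => ->; rewrite expr1n eq_sym oppr1_neq1.
apply/eqP => y1; have := @rootC_lt0 algC 7 (-1) isT.
by rewrite -/y y1 ltrN10.
Qed.

(** The number [zeta 6] is a cube root of -1, so only the value -1 must be excluded. It would make
    [y] purely imaginary, against the maximality of its real part. *)
Lemma zeta6_prim : 6.-primitive_root (zeta 6).
Proof.
set y : algC := 6.-root (-1); have y6 : y ^+ 6 = -1 by apply: rootCK.
have Dz : zeta 6 = y ^+ 2 by [].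
have z3 : zeta 6 ^+ 3 = -1 by rewrite Dz -exprM.
have zn1 : zeta 6 != -1.
  apply/eqP; rewrite Dz => y2.
  have Ry : 'Re y = 0.
    have yU : root_of_unity y.
      by apply/root_of_unityP; exists 12%N; rewrite // (exprM y 6 2) y6 sqrrN expr1n.
    have -> : 'Re y = (y + y^-1) / 2%:R by rewrite -root_of_unity_conj // ReE.
    rewrite (_ : y^-1 = - y) ?subrr ?mul0r //.
    apply: (mulfI (root_of_unity_neq0 yU)).
    by rewrite divff ?root_of_unity_neq0 // mulrN -expr2 y2 opprK.
  (* e^(i pi / 6) = (sqrt 3 + i) / 2 is a sixth root of -1 with positive real part. *)
  pose r : algC := sqrtC (3%:R / 4%:R).
  have r2 : r ^+ 2 = 3%:R / 4%:R by apply: sqrtCK.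
  have r0 : 0 < r by rewrite sqrtC_gt0 divr_gt0 ?ltr0n.
  have rR : r \is Num.real by apply: gtr0_real.
  have hR : (2%:R^-1 : algC) \is Num.real by rewrite gtr0_real ?invr_gt0 ?ltr0n.
  have := @rootC_Re_max algC 6 (-1) (r + 'i * 2%:R^-1) isT.
  rewrite Re_rect // Im_rect // -/y Ry invr_ge0 ler0n (lt_geF r0) => H.
  suff e6 : (r + 'i * 2%:R^-1) ^+ 6 = -1 by have := H e6 isT.
  have -> : (r + 'i * 2%:R^-1) ^+ 6 = ((r + 'i * 2%:R^-1) ^+ 3) ^+ 2 by rewrite -exprM.
  have -> : (r + 'i * 2%:R^-1) ^+ 3 = r * (r ^+ 2 + 3%:R / 4%:R * 'i ^+ 2) +
      'i * (3%:R / 2%:R * r ^+ 2 + 'i ^+ 2 / 8%:R).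
    by field.
  rewrite r2 sqrCi mulrN1 subrr mulr0 add0r exprMn sqrCi.
  rewrite (_ : _ + _ / _ = 1) ?expr1n ?mulr1 //; by field.
have z6 : zeta 6 ^+ 6 = 1 by rewrite (exprM _ 3 2) z3 sqrrN expr1n.
apply: primitive_root_cofactors => // p p_pr.
rewrite (@Euclid_dvdM 2 3) // !dvdn_prime2 // => /orP[] /eqP->; first by rewrite z3 oppr1_neq1.
apply: contra zn1 => /eqP z2.
by rewrite -z3 exprSr z2 mul1r.
Qed.

Lemma Q_sub_trans x y z : Q_sub x y -> Q_sub y z -> Q_sub x z.
Proof.
move=> /Q_subP[p ->] /Q_subP[q ->]; apply/Q_subP; exists (p \Po q).
by rewrite map_comp_poly horner_comp.
Qed.

Lemma Q_sub_cyc_gen k l : (0 < k)%N -> (0 < l)%N -> (k %| l)%N ->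
  Q_sub (cyc_gen k) (cyc_gen l).
Proof.
move=> k0 l0 /dvdnP[j Dl]; have kl : cyc_gen k ^+ l = 1.
  by rewrite Dl mulnC exprM (prim_expr_order (cyc_genP k0)) expr1n.
have [i ->] := prim_rootP (cyc_genP l0) kl.
by apply/Q_subP; exists 'X^i; rewrite map_polyXn hornerXn.
Qed.

Section Conductor.

Variable m : nat.
Local Notation M := m.+2.
Local Notation G := {unit 'I_M}.

Lemma unit_Zp_gt0 (u : G) : (0 < val u)%N.
Proof.
by have := unit_Zp_coprime u; case: (nat_of_ord _) => //; rewrite /coprime gcd0n.
Qed.

Lemma stab_cyc_gen k (u : G) : (0 < k)%N -> (k %| M)%N ->
  (u \in stab m (cyc_gen k)) = (val u == 1 %[mod k])%N.
Proof.
move=> k0 kM; have prk := cyc_genP k0.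
have kM1 : cyc_gen k ^+ M = 1.
  by have /dvdnP[j ->] := kM; rewrite mulnC exprM (prim_expr_order prk) expr1n.
by rewrite inE cycautE // -{2}[cyc_gen k]expr1 (eq_prim_root_expr prk).
Qed.

End Conductor.

Lemma simultaneous_congruence n d u : (0 < n)%N -> (0 < u)%N -> u = 1 %[mod gcdn n d] ->
  exists2 k, k = u %[mod n] & k = 1 %[mod d].
Proof.
move=> n0 u0 /eqP; rewrite eqn_mod_dvd // => /dvdnP[t Dt].
have {Dt} Du : u = (1 + t * gcdn n d)%N by rewrite -Dt subnKC.
have [a _ /dvdnP[b Db]] := Bezoutl d n0; set g := gcdn n d in Du Db.
(* Bezout gives a d = - g modulo n, and the factor [n.-1] plays the role of -1 modulo n, so the
   product is t g = u - 1 modulo n. *)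
exists (1 + (a * t * n.-1) * d)%N; last by rewrite addnC modnMDl.
apply/eqP; rewrite Du -(eqn_modDr (t * n.-1 * g)).
have -> : (1 + a * t * n.-1 * d + t * n.-1 * g = t * n.-1 * b * n + 1)%N.
  by rewrite -[(t * n.-1 * b * n)%N]mulnA -Db; ring.
have -> : (1 + t * g + t * n.-1 * g = t * g * n + 1)%N.
  by rewrite -{2}(prednK n0) mulnS; ring.
by rewrite !modnMDl.
Qed.

(** An automorphism u trivial on the field of order gcd(n, d) agrees on the n-th field with some v
    trivial on the d-th one. Then v fixes x because x lies in the d-th field, and u x = v x because
    x lies in the n-th. *)
Lemma Q_sub_gcdn x n d : (0 < n)%N -> (0 < d)%N ->
  Q_sub x (cyc_gen n) -> Q_sub x (cyc_gen d) -> Q_sub x (cyc_gen (gcdn n d)).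
Proof.
move=> n0 d0 xn xd; have g0 : (0 < gcdn n d)%N by rewrite gcdn_gt0 n0.
have [n1 | n1] := eqVneq n 1%N; first by rewrite n1 gcd1n -n1.
have [m Dm] : exists m, m.+2 = (n * d)%N.
  have nd : (1 < n * d)%N by apply: leq_trans (leq_pmulr n d0); rewrite ltn_neqAle eq_sym n1.
  by exists (n * d).-2; case: (n * d)%N nd => [|[]].
have nM : (n %| m.+2)%N by rewrite Dm dvdn_mulr.
have dM : (d %| m.+2)%N by rewrite Dm dvdn_mull.
have gM : (gcdn n d %| m.+2)%N by apply: dvdn_trans nM; apply: dvdn_gcdl.
have QM k : (0 < k)%N -> (k %| m.+2)%N -> Q_sub (cyc_gen k) (cyc_gen m.+2).
  by move=> k0; apply: Q_sub_cyc_gen.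
rewrite (@Q_sub_stab m) ?QM //; last exact: Q_sub_trans xn (QM _ _ _).
apply/subsetP => u; rewrite stab_cyc_gen // => /eqP ug.
have [k kn kd] := simultaneous_congruence n0 (unit_Zp_gt0 u) ug.
have kM : coprime k m.+2.
  rewrite Dm coprimeMr -[coprime k n]coprime_modl kn coprime_modl.
  rewrite -[coprime k d]coprime_modl kd coprime_modl coprime1n andbT.
  exact: coprime_dvdr nM (unit_Zp_coprime u).
have [v Dv] := unit_of_coprime kM.
have vd : v \in stab m (cyc_gen d) by rewrite stab_cyc_gen // Dv /= modn_dvdm // kd.
have xM : Q_sub x (cyc_gen m.+2) by apply: Q_sub_trans xn (QM _ n0 nM).
have /subsetP/(_ v vd)/stabP vx : stab m (cyc_gen d) \subset stab m x.
  by rewrite -(@Q_sub_stab m) // QM.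
have uv : cycaut u (cyc_gen n) = cycaut v (cyc_gen n).
  have nM1 : cyc_gen n ^+ m.+2 = 1.
    by have /dvdnP[j ->] := nM; rewrite mulnC exprM (prim_expr_order (cyc_genP n0)) expr1n.
  rewrite !cycautE // Dv; apply/eqP; rewrite (eq_prim_root_expr (cyc_genP n0)).
  by rewrite /= modn_dvdm // kn.
apply/stabP; rewrite -[RHS]vx; move: xn => /Q_subP[p ->].
rewrite -!horner_map uv -!map_poly_comp; congr (_.[_]).
by apply: eq_map_poly => c /=; rewrite !fmorph_rat.
Qed.

Lemma conductor_dvdn x n d :
  has_conductor x n -> (0 < d)%N -> Q_sub x (cyc_gen d) -> (n %| d)%N.
Proof.
move=> [n0 xn n_min] d0 xd; have g0 : (0 < gcdn n d)%N by rewrite gcdn_gt0 n0.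
have := n_min _ g0 (Q_sub_gcdn n0 d0 xn xd); rewrite -{1}(gcdnC d) => ng.
suff -> : n = gcdn n d by apply: dvdn_gcdr.
by apply/eqP; rewrite eqn_leq gcdnC ng gcdnC dvdn_leq ?dvdn_gcdl.
Qed.

(** * From the conductor to an index, and the form of the extremal numbers *)

Lemma exact_exponent (s : seq algC) : (forall x, x \in s -> root_of_unity x) ->
  exists d, [/\ (0 < d)%N, forall x, x \in s -> x ^+ d = 1 &
    forall k, (forall x, x \in s -> x ^+ k = 1) -> (d %| k)%N].
Proof.
move=> /common_exponent[N N0 sN].
pose P k := (0 < k)%N && all (fun x : algC => x ^+ k == 1) s.
have exP : exists k, P k by exists N; rewrite /P N0; apply/allP => x /sN ->.
case: (ex_minnP exP) => d /andP[d0 /allP sd] d_min.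
have {}sd x : x \in s -> x ^+ d = 1 by move/sd/eqP.
exists d; split=> // k sk; have g0 : (0 < gcdn k d)%N by rewrite gcdn_gt0 d0 orbT.
suff /eqP <- : gcdn k d == d by apply: dvdn_gcdl.
rewrite eqn_leq dvdn_leq ?dvdn_gcdr //= d_min // /P g0; apply/allP => x xs /=.
have [l prx ld] := prim_order_exists d0 (sd x xs).
by rewrite -(prim_order_dvd prx) dvdn_gcd ld andbT (prim_order_dvd prx) sk.
Qed.

Lemma prim_order_unity (x : algC) : root_of_unity x -> exists N, N.-primitive_root x.
Proof. by move=> /root_of_unityP[n n0 xn]; have [N] := prim_order_exists n0 xn; exists N. Qed.

(** The modulus is 210 d, with d the least common exponent of the terms, to make it divisible by 30
    and 42. A unit fixing all terms is 1 modulo d, hence modulo n, which divides d. *)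
Lemma conductor_degree_le alpha n s : has_conductor alpha n ->
  (forall x, x \in s -> root_of_unity x) -> alpha = \sum_(x <- s) x ->
  exists m (H : {group {unit 'I_m.+2}}),
    [/\ (210 %| m.+2)%N, forall x, x \in s -> x ^+ m.+2 = 1, Q_sub alpha (cyc_gen m.+2),
        H = stab m alpha :> {set _} &
        (Q_degree (cyc_gen n) alpha <= #|H : H :&: fixes m s|%g)%N].
Proof.
move=> cn sU Da; have [d [d0 sd d_min]] := exact_exponent sU.
have [n0 an _] := cn.
have ad : Q_sub alpha (cyc_gen d) by rewrite Da; apply: Q_sub_sum.
have nd := conductor_dvdn cn d0 ad.
have [m Dm] : exists m, m.+2 = (d * 210)%N.
  by exists (d * 210).-2; move: d0; case: d {sd d_min ad nd} => // d _; rewrite mulSn.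
have dM : (d %| m.+2)%N by rewrite Dm dvdn_mulr.
have nM : (n %| m.+2)%N by apply: dvdn_trans dM.
have sM x : x \in s -> x ^+ m.+2 = 1.
  by move=> xs; rewrite Dm exprM sd // expr1n.
have aM : Q_sub alpha (cyc_gen m.+2) by apply: Q_sub_trans ad (Q_sub_cyc_gen _ _ dM).
exists m, (stabG aM); split=> //; first by rewrite Dm dvdn_mull.
have zM : Q_sub (cyc_gen n) (cyc_gen m.+2) by apply: Q_sub_cyc_gen.
have [K DK] := fixes_group sM.
rewrite (Q_degree_stab aM zM) -DK indexgI.
rewrite -divgI; apply: leq_div2l; first exact: (cardG_gt0 (stabG aM :&: K)).
apply/subset_leq_card; apply/subsetP => u /setIP[_]; rewrite DK => /fixesP us.
rewrite stab_cyc_gen //; have u0 := unit_Zp_gt0 u.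
rewrite eqn_mod_dvd //; apply: dvdn_trans nd _; apply: d_min => x xs.
have xU : x \is a GRing.unit by rewrite unitfE; apply/root_of_unity_neq0/sU.
by rewrite exprB // expr1 -cycautE ?sM // us // divrr.
Qed.

Definition exceptional (alpha : algC) :=
  exists (c : 'Z_6) (a : 'Z_7) (epsilon : algC) (N : nat),
     [/\ c \is a GRing.unit, a \is a GRing.unit, N.-primitive_root epsilon,
         [&& 4 %| N, ~~ (3 %| N) & ~~ (7 %| N)]%N &
         alpha = epsilon * (zeta 6 ^+ c + zeta 7 ^+ a +
                            zeta 7 ^+ (2 * a) + zeta 7 ^+ (4 * a))].

Lemma prim_zeta n (x z : algC) : n.+2.-primitive_root z -> n.+2.-primitive_root x ->
  exists2 a : 'Z_n.+2, a \is a GRing.unit & x = z ^+ a.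
Proof.
move=> prz prx; have [i Di] := prim_rootP prz (prim_expr_order prx).
exists i; last by [].
rewrite -[X in X \is a _](natr_Zp i) (@unitZpE n.+2) // coprime_sym.
by rewrite -(prim_root_exp_coprime i prz) -Di.
Qed.

(* The order conditions on x0 are read off the action of the two symmetries on
   the roots of unity of order 7, 3 and 2 that are powers of x0. *)
Lemma symmetry_order (f g : {rmorphism algC -> algC}) x0 z w N :
  6.-primitive_root z -> 7.-primitive_root w -> N.-primitive_root x0 ->
  f w = w ^+ 2 -> f x0 = x0 -> g z = z ^+ 5 -> g x0 = - x0 ->
  [&& 4 %| N, ~~ (3 %| N) & ~~ (7 %| N)]%N.
Proof.
move=> z6 w7 x0N fw fx gz gx; have N0 := prim_order_gt0 x0N.
have N2 : (2 %| N)%N.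
  have := prim_expr_order x0N => /(congr1 g); rewrite rmorphXn gx rmorph1 exprNn.
  rewrite (prim_expr_order x0N) mulr1 -signr_odd dvdn2 => /eqP.
  by case: odd => //; rewrite expr1 (negPf oppr1_neq1).
apply/and3P; split.
(* The power [x0 ^+ (N %/ 2)] is -1, which [g] fixes; but [g] also multiplies it by the sign of
   parity N / 2, so N / 2 is even. *)
- have y2 := dvdn_prim_root x0N N2.
  have y1 := prim_root2 y2.
  have := y1 => /(congr1 g); rewrite rmorphXn gx rmorphN1 exprNn y1 -signr_odd.
  case E: (odd _).
    by rewrite expr1 mulN1r opprK => /eqP; rewrite eq_sym (negPf oppr1_neq1).
  by move=> _; rewrite -(divnK N2) (@dvdn_pmul2r 2 2) // dvdn2 E.
(* Acting on powers of [x0] by signs, [g] fixes [y ^+ 2]; as [g] inverts sixth roots of unity, it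
   also sends [y] to [y ^+ 2]. A primitive cube root of unity cannot satisfy both. *)
- apply/negP => N3; have y3 := dvdn_prim_root x0N N3; set y := x0 ^+ (N %/ 3) in y3.
  have y6 : y ^+ 6 = 1 by rewrite (exprM y 3 2) (prim_expr_order y3) expr1n.
  have gy : g y = y ^+ 2.
    have [i Di] := prim_rootP z6 y6.
    by rewrite Di rmorphXn gz exprAC -Di (exprD y 3 2) (prim_expr_order y3) mul1r.
  have : y ^+ 2 ^+ 2 = y ^+ 2.
    by rewrite -[X in X ^+ 2 = _]gy /y rmorphXn gx -!exprM mulnC !exprM sqrrN.
  move=> /eqP; rewrite -exprM (eq_prim_root_expr y3) //.
- apply/negP => N7; have y7 := dvdn_prim_root x0N N7; set y := x0 ^+ (N %/ 7) in y7.
  have fy : f y = y by rewrite rmorphXn fx.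
  have [i Di] := prim_rootP w7 (prim_expr_order y7).
  have : y ^+ 2 = y ^+ 1 by rewrite expr1 -[RHS]fy Di rmorphXn fw exprAC.
  by move=> /eqP; rewrite (eq_prim_root_expr y7).
Qed.

Lemma extremal_exceptional m (H : {group {unit 'I_m.+2}}) s :
  extremal_symmetry H s -> exceptional (\sum_(x <- s) x).
Proof.
move=> [x0 [z [w [[x0U z6 w7 ps] [u _ [_ uw ux]] [v _ [vz _ vx]]]]]].
have [N x0N] := prim_order_unity x0U.
have [c cU Dc] := prim_zeta zeta6_prim z6.
have [a aU Da] := prim_zeta zeta7_prim w7.
exists c, a, x0, N; split=> //; first exact: symmetry_order uw ux vz vx.
rewrite (perm_big _ ps) /= !big_cons big_nil.
by rewrite ![(_ * nat_of_ord a)%N]mulnC !exprM -Dc -Da; ring.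
Qed.

(** * Lower bound for the degree of the exceptional numbers *)

Lemma size_le_index (gT : finGroupType) (T : eqType) (H K : {group gT})
    (f : gT -> T) (L : seq T) : uniq L ->
  {in H & K, forall u v, f (v * u)%g = f u} ->
  {in L, forall y, exists2 u, u \in H & f u = y} -> (size L <= #|H : K|%g)%N.
Proof.
move=> uL fK fL.
have : (size L <= size [seq f (repr C) | C <- enum (rcosets K H)])%N.
  apply: uniq_leq_size uL _ => y /fL[u uH <-]; apply/mapP.
  exists (K :* u)%g; first by rewrite mem_enum; apply/rcosetsP; exists u.
  by have /rcosetP[v vK ->] := mem_repr_rcoset K u; rewrite fK.
by rewrite size_map -cardE.
Qed.

(** The two Gaussian periods are the roots of X^2 + X + 2, whose discriminant -7 is nonzero. *)
Lemma period7_neq (w : algC) : 7.-primitive_root w ->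
  w + w ^+ 2 + w ^+ 4 <> w ^+ 6 + w ^+ 5 + w ^+ 3.
Proof.
move=> w7 e; have S := sum_unity7 w7; set h := w + w ^+ 2 + w ^+ 4 in e S.
have h2 : 2%:R * h = -1 by apply/eqP; rewrite -subr_eq0 -S -e; apply/eqP; ring.
have hh : h ^+ 2 = -2%:R - h.
  have -> : h ^+ 2 = w ^+ 2 + w ^+ 4 + w ^+ 8 + 2%:R * (w ^+ 6 + w ^+ 5 + w ^+ 3).
    by rewrite /h; ring.
  have -> : w ^+ 8 = w by rewrite -(prim_expr_mod w7).
  have -> : w ^+ 6 + w ^+ 5 + w ^+ 3 = - 1 - h.
    by apply/eqP; rewrite -subr_eq0 -S; apply/eqP; ring.
  by rewrite /h; ring.
have : 7%:R = 0 :> algC.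
  have -> : 7%:R = 4%:R * (h ^+ 2 - (-2%:R - h)) - (2%:R * h + 1) ^+ 2 :> algC by ring.
  by rewrite hh h2 subrr mulr0 addNr expr0n subrr.
by move/eqP; rewrite pnatr_eq0.
Qed.

Section Converse.

Variables (z w epsilon alpha : algC) (N : nat).
Hypotheses (z6 : 6.-primitive_root z) (w7 : 7.-primitive_root w).
Hypothesis eN : N.-primitive_root epsilon.
Hypotheses (N4 : (4 %| N)%N) (N3 : ~~ (3 %| N)%N) (N7 : ~~ (7 %| N)%N).
Hypothesis Da : alpha = epsilon * heptasum z w.

Let N0 : (0 < N)%N. Proof. exact: prim_order_gt0 eN. Qed.
Let e0 : epsilon != 0. Proof. exact: expr_eq1_neq0 N0 (prim_expr_order eN). Qed.

Variables (m n : nat).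
Local Notation M := m.+2.
Local Notation G := {unit 'I_M}.
Hypotheses (DM : M = (21 * N)%N) (cn : has_conductor alpha n).

Let unityM x k : (k %| M)%N -> x ^+ k = 1 -> x ^+ M = 1 :> algC.
Proof. by move=> /dvdnP[j ->] xk; rewrite mulnC exprM xk expr1n. Qed.

Let N_M : (N %| M)%N. Proof. by rewrite DM dvdn_mull. Qed.
Let six_M : (6 %| M)%N.
Proof. by rewrite DM (@dvdn_mul 3 2) //; apply: dvdn_trans N4. Qed.
Let seven_M : (7 %| M)%N. Proof. by rewrite DM dvdn_mulr. Qed.

Let cycautX (u : G) x k j : (k %| M)%N -> x ^+ k = 1 -> val u = j %[mod k] ->
  cycaut u x = x ^+ j.
Proof.
by move=> kM xk uj; rewrite cycautE ?(unityM kM) //; apply: expr_eqmod uj.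
Qed.

Let aM : Q_sub alpha (cyc_gen M).
Proof.
rewrite Da; have -> : epsilon * heptasum z w = \sum_(x <- [:: epsilon * z; epsilon * w;
    epsilon * w ^+ 2; epsilon * w ^+ 4]) x.
  by rewrite !big_cons big_nil /heptasum; ring.
have eM := unityM N_M (prim_expr_order eN).
have zM := unityM six_M (prim_expr_order z6).
have wM := unityM seven_M (prim_expr_order w7).
apply: Q_sub_sum => // x; rewrite !inE => /or4P[] /eqP->.
- by rewrite exprMn eM zM mulr1.
- by rewrite exprMn eM wM mulr1.
- by rewrite exprMn eM exprAC wM expr1n mulr1.
- by rewrite exprMn eM exprAC wM expr1n mulr1.
Qed.

Let nM : (n %| M)%N. Proof. exact: conductor_dvdn cn _ aM. Qed.

Let n0 : (0 < n)%N. Proof. by case: cn. Qed.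

Let conductor_stab (u : G) : val u = 1 %[mod n] -> cycaut u alpha = alpha.
Proof.
move=> un; have [_ an _] := cn; apply/stabP.
have zM : Q_sub (cyc_gen n) (cyc_gen M) by apply: Q_sub_cyc_gen.
have /subsetP : stab m (cyc_gen n) \subset stab m alpha by rewrite -Q_sub_stab.
by apply; rewrite stab_cyc_gen // un.
Qed.

Let cycaut_alpha (u : G) :
  cycaut u alpha = cycaut u epsilon * heptasum (cycaut u z) (cycaut u w).
Proof. by rewrite Da rmorphM /heptasum !rmorphD !rmorphXn. Qed.

(* Automorphisms with prescribed exponents modulo 3, 7 and N; z has order 6,
   but z = - z ^+ 4 and z ^+ 4 has order 3. *)
Let aut_exists r3 r7 r : coprime r3 3 -> coprime r7 7 -> coprime r N ->
  exists u : G, [/\ val u = r3 %[mod 3], val u = r7 %[mod 7] & val u = r %[mod N]].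
Proof.
move=> c3 c7 c; have co37 : coprime 3 7 by [].
have coN : coprime (3 * 7) N by rewrite coprimeMl !prime_coprime // N3.
pose k := chinese 21 N (chinese 3 7 r3 r7) r.
have kN : k = r %[mod N] by apply: chinese_modr.
have k21 : k = chinese 3 7 r3 r7 %[mod 21] by apply: chinese_modl.
have k3 : k = r3 %[mod 3].
  rewrite -(modn_dvdm k (isT : 3 %| 21)%N) k21 modn_dvdm //; exact: chinese_modl.
have k7 : k = r7 %[mod 7].
  rewrite -(modn_dvdm k (isT : 7 %| 21)%N) k21 modn_dvdm //; exact: chinese_modr.
have kM : coprime k M.
  rewrite DM -[21%N]/(3 * 7)%N !coprimeMr -[coprime k 3]coprime_modl k3 coprime_modl c3.
  rewrite -[coprime k 7]coprime_modl k7 coprime_modl c7 /=.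
  by rewrite -coprime_modl kN coprime_modl.
have [u Du] := unit_of_coprime kM; exists u.
have M3 : (3 %| M)%N by apply: dvdn_trans six_M.
by rewrite Du /= !modn_dvdm.
Qed.

Let z_aut r (u : G) : val u = r %[mod 3] -> cycaut u z = - (z ^+ 4) ^+ r.
Proof.
move=> u3; have z3 := sixth_root_cube z6.
have z43 : (z ^+ 4) ^+ 3 = 1 by rewrite -exprM (exprM z 6 2) (prim_expr_order z6) expr1n.
have {1}-> : z = - z ^+ 4 by rewrite exprS z3 mulrN1 opprK.
by rewrite rmorphN (cycautX (dvdn_trans (isT : 3 %| 6)%N six_M) z43 u3).
Qed.

Let z1 : - (z ^+ 4) ^+ 1 = z.
Proof.
have := @z_aut 1 1%g erefl.
by rewrite cycaut1 ?Q_sub_unity ?(unityM six_M (prim_expr_order z6)).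
Qed.

Let z2 : - (z ^+ 4) ^+ 2 = z ^+ 5.
Proof.
by rewrite -exprM (exprD z 3 5) (sixth_root_cube z6) mulN1r opprK.
Qed.

Let w_aut r (u : G) : val u = r %[mod 7] -> cycaut u w = w ^+ r.
Proof. by move=> u7; apply: cycautX seven_M _ u7; apply: prim_expr_order. Qed.

Let e_aut r (u : G) : val u = r %[mod N] -> cycaut u epsilon = epsilon ^+ r.
Proof. by move=> uN; apply: cycautX N_M _ uN; apply: prim_expr_order. Qed.

(** Otherwise the automorphism that is -1 modulo 7 and trivial modulo 3 N would fix [alpha],
    although it exchanges the two distinct Gaussian periods. *)
Let n7 : (7 %| n)%N.
Proof.
apply: contraT; rewrite -prime_coprime // => n7.
have n3N : (n %| 3 * N)%N.
  by rewrite -(@Gauss_dvdr n 7) ?mulnA -?DM // coprime_sym.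
have [u [u3 u7 uN]] := aut_exists (isT : coprime 1 3) (isT : coprime 6 7) (coprime1n N).
have u3N : val u = 1 %[mod 3 * N].
  by apply/eqP; rewrite chinese_remainder ?prime_coprime // u3 uN !eqxx.
have := @conductor_stab u; rewrite cycaut_alpha (z_aut u3) z1 (w_aut u7) (e_aut uN) expr1 Da.
have -> : val u = 1 %[mod n].
  by rewrite -(modn_dvdm (val u) n3N) u3N modn_dvdm.
move=> /(_ erefl) /(mulfI e0); rewrite /heptasum -!exprM.
have -> : w ^+ (6 * 2) = w ^+ 5 by rewrite -(prim_expr_mod w7).
have -> : w ^+ (6 * 4) = w ^+ 3 by rewrite -(prim_expr_mod w7).
rewrite -!addrA => /addrI; rewrite !addrA => /esym.
by move/(period7_neq w7).
Qed.

(** Otherwise the automorphism that is -1 modulo 3 and trivial modulo 7 N would fix [alpha],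
    although it changes only [z], into [z ^+ 5]. *)
Let n3 : (3 %| n)%N.
Proof.
apply: contraT; rewrite -prime_coprime // => n3.
have n7N : (n %| 7 * N)%N.
  by rewrite -(@Gauss_dvdr n 3) ?mulnA -?DM // coprime_sym.
have [u [u3 u7 uN]] := aut_exists (isT : coprime 2 3) (isT : coprime 1 7) (coprime1n N).
have u7N : val u = 1 %[mod 7 * N].
  by apply/eqP; rewrite chinese_remainder ?prime_coprime // u7 uN !eqxx.
have := @conductor_stab u; rewrite cycaut_alpha (z_aut u3) z2 (w_aut u7) (e_aut uN) expr1 Da.
have -> : val u = 1 %[mod n].
  by rewrite -(modn_dvdm (val u) n7N) u7N modn_dvdm.
move=> /(_ erefl) /(mulfI e0) /addIr /addIr /addIr.
by rewrite -[RHS]expr1 => /eqP; rewrite (eq_prim_root_expr z6).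
Qed.

(** Divisibility of N by 4 makes N / 2 even, so the exponent N / 2 + 1, which changes the sign of
    [epsilon], is odd and defines an automorphism. *)
Let half_coprime : coprime (N %/ 2).+1 N.
Proof.
have /dvdnP[j Dj] := N4; have -> : (N %/ 2 = j * 2)%N.
  by rewrite Dj -[4%N]/(2 * 2)%N mulnA mulnK.
by rewrite Dj -[4%N]/(2 * 2)%N mulnA coprimeMr coprimeSn coprimen2 /= oddM andbF.
Qed.

Let e_half : epsilon ^+ (N %/ 2).+1 = - epsilon.
Proof.
have N2 : (2 %| N)%N by apply: dvdn_trans N4.
by rewrite exprSr (prim_root2 (dvdn_prim_root eN N2)) mulN1r.
Qed.

Let symmetry j3 j7 j : coprime j3 3 -> coprime j7 7 -> coprime j N ->
  (j3 < 3)%N -> (j7 < 7)%N ->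
  epsilon ^+ j * heptasum (- (z ^+ 4) ^+ j3) (w ^+ j7) = alpha ->
  exists2 u : G, u \in stab m alpha & (val u %% 3, val u %% 7)%N = (j3, j7).
Proof.
move=> c3 c7 cN l3 l7 ja; have [u [u3 u7 uN]] := aut_exists c3 c7 cN.
exists u; last by rewrite u3 u7 !modn_small.
by apply/stabP; rewrite cycaut_alpha (z_aut u3) (w_aut u7) (e_aut uN).
Qed.

Lemma exceptional_degree_ge : (6 <= Q_degree (cyc_gen n) alpha)%N.
Proof.
have zM : Q_sub (cyc_gen n) (cyc_gen M) by apply: Q_sub_cyc_gen.
rewrite (Q_degree_stab aM zM).
have KH : (stabG zM \subset stabG aM)%g by rewrite /= -Q_sub_stab //; case: cn.
rewrite -[#|stab m alpha|]/#|stabG aM| -[#|stab m (cyc_gen n)|]/#|stabG zM| divgS //.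
(* The pairs of residues modulo 3 and 7 with equal quadratic characters. Squares modulo 7 go with an
   automorphism fixing [epsilon], non-squares with one negating it, which compensates the sign in
   [heptasum_conj]. *)
pose L := [:: (1, 1); (1, 2); (1, 4); (2, 6); (2, 5); (2, 3)]%N.
apply: (size_le_index (f := fun u : G => (val u %% 3, val u %% 7)%N) (L := L)) => //.
  move=> u v _; rewrite /= stab_cyc_gen // => /eqP vn.
  have v1 k : (k %| n)%N -> val v = 1 %[mod k].
    by move=> kn; rewrite -(modn_dvdm _ kn) vn modn_dvdm.
  have vu k : (k %| n)%N -> (val (v * u)%g %% k = val u %% k)%N.
    move=> kn; rewrite /= modn_dvdm ?(dvdn_trans kn) //.
    by rewrite -modnMml v1 // modnMml mul1n.
  by rewrite !vu.
have hsq := heptasum_sq z6 w7.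
have w4 : w ^+ 4 = w ^+ 2 ^+ 2 by rewrite -exprM.
have w2_7 : 7.-primitive_root (w ^+ 2) by rewrite prim_root_exp_coprime.
have hsq2 : heptasum z (w ^+ 4) = heptasum z w by rewrite w4 heptasum_sq.
have w4_7 : 7.-primitive_root (w ^+ 4) by rewrite prim_root_exp_coprime.
have w5 : w ^+ 5 = w ^+ 2 ^+ 6 by rewrite -exprM -[RHS](prim_expr_mod w7).
have w3 : w ^+ 3 = w ^+ 4 ^+ 6.
  by rewrite -exprM -[RHS](prim_expr_mod w7).
move=> _ /(nthP (0, 0)%N)[i i6 <-]; move: i i6.
case=> [|[|[|[|[|[|//]]]]]] _; rewrite /nth.
- by apply: (symmetry (j := 1)); rewrite ?coprime1n // z1 !expr1.
- by apply: (symmetry (j := 1)); rewrite ?coprime1n // z1 expr1 hsq.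
- by apply: (symmetry (j := 1)); rewrite ?coprime1n // z1 expr1 hsq2.
- by apply: (symmetry (j := (N %/ 2).+1)); rewrite // z2 e_half heptasum_conj // mulrNN.
- by apply: (symmetry (j := (N %/ 2).+1)); rewrite // z2 e_half w5 heptasum_conj // hsq mulrNN.
- by apply: (symmetry (j := (N %/ 2).+1)); rewrite // z2 e_half w3 heptasum_conj // hsq2 mulrNN.
Qed.

End Converse.

Lemma exceptional_degree alpha n : exceptional alpha -> has_conductor alpha n ->
  (6 <= Q_degree (cyc_gen n) alpha)%N.
Proof.
move=> [c [a [e [N [cU aU eN /and3P[N4 N3 N7] Da]]]]] cn.
have prim k (z : algC) (i : 'Z_k.+2) : k.+2.-primitive_root z -> i \is a GRing.unit ->
    k.+2.-primitive_root (z ^+ i).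
  move=> prz; rewrite -[X in X \is a _](natr_Zp i) (@unitZpE k.+2) // coprime_sym => co.
  by rewrite prim_root_exp_coprime.
have N0 := prim_order_gt0 eN.
have [m Dm] : exists m, m.+2 = (21 * N)%N by exists (21 * N).-2; rewrite -(prednK N0) mulnS.
apply: (exceptional_degree_ge (prim _ _ _ zeta6_prim cU) (prim _ _ _ zeta7_prim aU) eN
          N4 N3 N7 _ Dm cn).
by rewrite Da /heptasum ![(_ * nat_of_ord a)%N]mulnC !exprM.
Qed.

Theorem theorem5 (alpha : algC) (n : nat)
    (Halpha : cyclotomic_integer alpha)
    (Hlength : has_length alpha 4)
    (Hconductor : has_conductor alpha n) :
  (Q_degree (cyc_gen n) alpha <= 6)%N /\
  (Q_degree (cyc_gen n) alpha = 6%N <->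
   exists (c : 'Z_6) (a : 'Z_7) (epsilon : algC) (N : nat),
     [/\ c \is a GRing.unit, a \is a GRing.unit, N.-primitive_root epsilon,
         [&& 4 %| N, ~~ (3 %| N) & ~~ (7 %| N)]%N &
         alpha = epsilon * (zeta 6 ^+ c + zeta 7 ^+ a +
                            zeta 7 ^+ (2 * a) + zeta 7 ^+ (4 * a))]).
Proof.
have [[s [s4 sU Da]] len_min] := Hlength.
have s_min : minrep s.
  split=> // t tU ts; rewrite s4; apply: len_min; exists t; split=> //.
  by rewrite Da ts.
have [m [H [M210 sM aM DH deg_le]]] := conductor_degree_le Hconductor sU Da.
have Hs : {in H, forall u, \sum_(x <- s) cycaut u x = \sum_(x <- s) x}.
  by move=> u; rewrite DH => /stabP; rewrite Da rmorph_sum.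
have [i6 i6_sym] := index_fixes_le M210 sM s_min s4 Hs.
have deg6 : (Q_degree (cyc_gen n) alpha <= 6)%N by apply: leq_trans i6.
split=> //; split=> [deg | ex]; last first.
  by apply/eqP; rewrite eqn_leq deg6; apply: exceptional_degree.
rewrite Da; apply: (@extremal_exceptional m H); apply: i6_sym.
by apply/eqP; rewrite eqn_leq i6 -{1}deg.
Qed.
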